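(* Let $F$ be a random self-affine function, and let $s$ be the unique solution to the equation $$1=\mathbb{E}\left(\sum_{i=0}^{m-1}a_il_i^{s-1}\right).$$ Then almost surely, $s$ is the box-counting dimension of the graph of $F$.
   Context: Let $m\ge 2$ and let $0=b_0<b_1<\dots<b_{m-1}<b_m=1$ be a fixed partition of $[0,1]$; put $l_i:=b_{i+1}-b_i$ for $i=0,\dots,m-1$. Let $\mathcal{I}_n:=\{0,1,\dots,m-1\}^n$ and $\mathcal{I}^*:=\bigcup_{n\ge 0}\mathcal{I}_n$ (the finite words, including the empty word $\varnothing$). For $\omega\in\mathcal{I}_n$ and $k\le n$, $\omega|_k=\omega_1\dots\omega_k$; $\omega i$ denotes concatenation. Let $(\Theta,\mathscr{F},\mathbb{P})$ be a probability space with expectation $\mathbb{E}$, and let $\{\mathbf{Y}_\omega=(y_{\omega 1},\dots,y_{\omega(m-1)}):\omega\in\mathcal{I}^*\}$ be independent random vectors on $\Theta$, with values in $[0,1]^{m-1}$, all having the same joint distribution; the coordinates of a single vector $\mathbf{Y}_\omega$ need not be independent. Write $\mathbf{Y}_\varnothing=(y_1,\dots,y_{m-1})$, and for every $\omega\in\mathcal{I}^*$ set $y_{\omega 0}:=0$, $y_{\omega m}:=1$ (so $y_0=0$, $y_m=1$). Assume $\mathbb{P}(y_i\in\{0,1\})=0$ for $i=1,\dots,m-1$, and $\mathbb{P}(y_{i+1}-y_i=b_{i+1}-b_i)<1$ for $i=1,\dots,m-1$. For $\omega\in\mathcal{I}^*$ and $i\in\{0,\dots,m-1\}$ let $T_{\omega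 i}:[0,1]^2\to[0,1]^2$ be the random affine map $$T_{\omega i}(x,y)=\big((b_{i+1}-b_i)x+b_i,\ (y_{\omega(i+1)}-y_{\omega i})y+y_{\omega i}\big).$$ For $n\ge1$ and $\omega\in\mathcal{I}_n$ let $R_\omega:=T_{\omega|_1}\circ T_{\omega|_2}\circ\dots\circ T_{\omega|_n}([0,1]^2)$, and let $\Gamma:=\bigcap_{n\ge1}\bigcup_{\omega\in\mathcal{I}_n}R_\omega$. With probability one $\Gamma$ is the graph of a continuous function $F:[0,1]\to[0,1]$; this random function $F$ is called a random self-affine function. For $i\in\{0,\dots,m-1\}$ let $a_i:=|y_{i+1}-y_i|$. For a bounded set $E\subseteq\mathbb{R}^n$ and $\delta>0$, $N_\delta(E)$ is the minimum number of cubes of side length $\delta$ needed to cover $E$. The upper and lower box-counting dimensions of $E$ are the $\limsup$ and $\liminf$ of $\log N_\delta(E)/(-\log\delta)$ as $\delta\to0$; if they agree, the common value is the box-counting dimension $\dim_B E$. *)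

(* Defs.v *)
From mathcomp Require Import all_boot all_order all_algebra.
From mathcomp Require Import all_classical all_reals all_analysis.

Set Implicit Arguments.
Unset Strict Implicit.
Unset Printing Implicit Defensive.

Import Order.TTheory GRing.Theory Num.Theory.
Import numFieldNormedType.Exports.

Local Open Scope classical_set_scope.
Local Open Scope ring_scope.

(* R carries its Borel sigma-algebra and a tuple type the product one, so an
   n-dimensional random vector is a random variable with values in this type. *)
Notation rvec R n := (n.-tuple (measurableTypeR R)).

Definition mutually_independent (d : measure_display) (Th : measurableType d)
    (R : realType) (P : probability Th R) (I : choiceType)
    (d' : measure_display) (T : measurableType d')
    (X : I -> {RV P >-> T}) : Prop :=
  forall (s : seq I) (A : I -> set T),
    uniq s -> (forall i, measurable (A i)) ->
    P (\bigcap_(i in [set` s]) (X i @^-1` A i)) =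
    (\prod_(i <- s) P (X i @^-1` A i))%E.

Definition identically_distributed (d : measure_display)
    (Th : measurableType d) (R : realType) (P : probability Th R) (I : Type)
    (d' : measure_display) (T : measurableType d')
    (X : I -> {RV P >-> T}) : Prop :=
  forall (i j : I) (A : set T), measurable A ->
    distribution P (X i) A = distribution P (X j) A.

(* Only b 0, ..., b m are relevant. *)
Definition is_partition (R : realType) (m : nat) (b : nat -> R) : Prop :=
  [/\ b 0%N = 0, b m = 1 & forall i, (i < m)%N -> b i < b i.+1].

(* (v_1, ..., v_n) extended by v_0 = 0 and v_(n+1) = 1. *)
Definition ext01 (R : realType) (n : nat) (v : rvec R n) (i : nat) : R :=
  nth 0 (0 :: rcons v 1) i.

Section SelfAffine.
Variables (R : realType) (m : nat).
Implicit Types (b : nat -> R) (w u : seq 'I_m) (i : 'I_m).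

(* A realisation of the array (y_{w i}), with i ranging over 0, ..., m. *)
Implicit Types (y : seq 'I_m -> nat -> R).

Definition unit_square : set (R * R) := `[0, 1] `*` `[0, 1].

(* The map T_{w i}. *)
Definition affine_map b y w i (p : R * R) : R * R :=
  ((b i.+1 - b i) * p.1 + b i, (y w i.+1 - y w i) * p.2 + y w i).

(* For w = w_1 ... w_n, the composition
   T_{u w_1} \o T_{u w_1 w_2} \o ... \o T_{u w_1 ... w_n}. *)
Fixpoint affine_comp b y u w : R * R -> R * R :=
  if w is i :: w' then
    affine_map b y u i \o affine_comp b y (rcons u i) w'
  else id.

Definition rectangle b y w : set (R * R) :=
  affine_comp b y [::] w @` unit_square.

Definition limit_set b y : set (R * R) :=
  \bigcap_(n in [set n | (0 < n)%N])
    \bigcup_(w in [set w | size w = n]) rectangle b y w.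

End SelfAffine.

Definition graph01 (R : realType) (f : R -> R) : set (R * R) :=
  [set p | p.1 \in `[0, 1] /\ p.2 = f p.1].

(* The coordinates y_{w i} for 0 <= i <= m at the sample point t. *)
Definition y_ (d : measure_display) (Th : measurableType d) (R : realType)
    (P : probability Th R) (m : nat)
    (Y : seq 'I_m -> {RV P >-> rvec R m.-1})
    (t : Th) (w : seq 'I_m) (i : nat) : R :=
  ext01 (Y w t) i.

Definition random_self_affine_function (d : measure_display)
    (Th : measurableType d) (R : realType) (P : probability Th R) (m : nat)
    (b : nat -> R) (Y : seq 'I_m -> {RV P >-> rvec R m.-1})
    (F : Th -> R -> R) : Prop :=
  {ae P, forall t,
    [/\ {within `[0, 1], continuous (F t)},
        set_fun `[0, 1] `[0, 1] (F t) &
        limit_set b (y_ Y t) = graph01 (F t)]}.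

Section BoxDimension.
Variable R : realType.
Implicit Types (E : set (R * R)) (delta : R).

Definition square (c : R * R) delta : set (R * R) :=
  `[c.1, c.1 + delta] `*` `[c.2, c.2 + delta].

Definition coverable E delta (n : nat) : Prop :=
  exists c : 'I_n -> R * R, E `<=` \bigcup_k square (c k) delta.

(* The minimum exists as soon as E is bounded and delta > 0; the value is 0 by
   convention if there is no finite cover. *)
Definition covering_number E delta : nat :=
  xget 0%N [set n | coverable E delta n /\
                    forall k, coverable E delta k -> (n <= k)%N].

Definition box_ratio E delta : \bar R :=
  (ln (covering_number E delta)%:R / - ln delta)%:E.

Definition upper_box_dim E : \bar R := limf_esup (box_ratio E) 0^'+.

Definition lower_box_dim E : \bar R := limf_einf (box_ratio E) 0^'+.

Definition is_box_dim E (s : R) : Prop :=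
  lower_box_dim E = s%:E /\ upper_box_dim E = s%:E.

End BoxDimension.

(* Main.v *)
Require Import Defs.
From mathcomp Require Import all_boot all_order all_algebra.
From mathcomp Require Import all_classical all_reals all_analysis.
From mathcomp Require Import measurable_realfun.
From mathcomp Require Import ring lra.

Set Implicit Arguments.
Unset Strict Implicit.
Unset Printing Implicit Defensive.

Import Order.TTheory GRing.Theory Num.Theory.
Import numFieldNormedType.Exports.

Local Open Scope classical_set_scope.
Local Open Scope ring_scope.

(** Over the column of a word [w] (the interval of width [widthw w] that [w]
codes), the graph lies in the rectangle of [w], whose height [heightw w] is the
product of the numbers [a_i] met along [w], and it joins two opposite corners
of that rectangle.  Stop each infinite word as soon as its column is no wider
than [delta].  The stopped words ([cutset]) cut [0, 1] into columns of width
comparable to [delta], and over each column about [heightw w / delta + 1] squares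
of side [delta] are both necessary and sufficient.  The heights of the stopped
words have a sum that is at least 1, so the additional [1]s, of which there are
about [1 / delta], change the number of squares by at most a constant factor.
The number of squares is thus comparable to [delta^-1] times the sum of
[heightw w], that is to [delta^-s * M] where [M], the sum of
[heightw w * widthw w ^ (s - 1)] over the stopped words, is the [mass] of exponent
[s - 1] ([coverable_graph_ge], [coverable_limit_set], [is_box_dim_graph]).  It
remains to see that, almost surely, [M] stays between two positive constants
along the scales [delta = hi ^+ k] ([level_mass_pinched]).

The equation that defines [s] says that splitting a word preserves the mean of
[M], so this mean is 1 at all scales ([mean_mass]).

If [s = 1], then [M] is at least 1 and therefore almost surely equal to 1.

If [s > 1], the contributions of the stopped words to a change of scale are
orthogonal, and each of them carries a weight of order at most
[delta ^ (s - 1)]; hence the increments of [M] have second moments of that order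
([variance_increment]), their sum converges absolutely, and [M] is almost surely
bounded.  For the lower bound, let [q] be the supremum, over all words, of the
probability that [M] has lower limit 0 in the subtree hanging at the word.  The
mean 1 of [M] at a late scale cannot be lost in the small increments that
follow, so that [q < 1] ([vanishing_prob_lt1]).  On the
other hand the first and the last letter have positive heights almost surely,
so that vanishing at a word forces vanishing in two of its subtrees, which are
independent: hence [q <= q ^+ 2], and [q = 0] ([vanishing_prob_step],
[vanishing_null]). *)

(** * Powers of reals *)

Lemma powR_le1 (R : realType) (x p : R) : 0 <= p -> 0 <= x <= 1 -> x `^ p <= 1.
Proof.
move=> p0 /andP[x0 x1]; rewrite (_ : 1 = 1 `^ p); last by rewrite powR1.
by rewrite ge0_ler_powR// ?nnegrE.
Qed.

Lemma exists_small_power (R : realType) (q e : R) :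
  0 <= q < 1 -> 0 < e -> exists k, q ^+ k <= e.
Proof.
move=> /andP[q0 q1] e0; have : q ^+ k @[k --> \oo] --> (0 : R).
  by apply: cvg_expr; rewrite ger0_norm.
move/cvgrPdist_le => /(_ _ e0) [k _ /(_ k (leqnn k))].
by rewrite /= sub0r normrN ger0_norm ?exprn_ge0//; exists k.
Qed.

Lemma geometric_partial_sum_le (R : realType) (c q : R) n : 0 <= c -> 0 <= q < 1 ->
  \sum_(j < n) c * q ^+ j <= c / (1 - q).
Proof.
move=> c0 /andP[q0 q1]; have q10 : 0 < 1 - q by rewrite subr_gt0.
rewrite -mulr_sumr ler_wpM2l// -[leRHS]mul1r ler_pdivlMr// mulrC.
by rewrite -opprB mulNr -subrX1 opprB gerBl exprn_ge0.
Qed.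

(** * Independence of disjoint subfamilies *)

Section Independence.
Context (d : measure_display) (Th : measurableType d) (R : realType)
  (P : probability Th R) (I : choiceType) (d' : measure_display)
  (T : measurableType d') (X : I -> {RV P >-> T}).

(** The pi-system that generates the sigma-algebra of the variables indexed by
[J]: as only finitely many of them are constrained, its independence properties
are read off the product rule. *)
Definition cylinder (J : set I) : set (set Th) :=
  [set E | exists (s : seq I) (A : I -> set T),
    [/\ [set` s] `<=` J, forall i, measurable (A i) &
        E = \bigcap_(i in [set` s]) (X i @^-1` A i)]].

Lemma cylinder_measurable J : cylinder J `<=` measurable.
Proof.
move=> E [s [A [_ mA ->]]]; apply: fin_bigcap_measurable => // i _.
exact: measurable_funPTI.
Qed.

Lemma cylinderT J : cylinder J setT.
Proof.
exists [::], (fun=> setT); split => //.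
by rewrite [X in bigcap X](_ : _ = set0) ?bigcap_set0//; apply/seteqP; split.
Qed.

Lemma cylinder1 (J : set I) i (A : set T) :
  J i -> measurable A -> cylinder J (X i @^-1` A).
Proof.
move=> Ji mA; exists [:: i], (fun=> A); split => //.
  by move=> j /=; rewrite inE => /eqP ->.
by rewrite [X in bigcap X](_ : _ = [set i]) ?bigcap_set1//;
  apply/seteqP; split=> j /=; rewrite inE => /eqP.
Qed.

Lemma cylinderI J : setI_closed (cylinder J).
Proof.
move=> E F [s1 [A1 [s1J mA1 ->]]] [s2 [A2 [s2J mA2 ->]]].
exists (s1 ++ s2), (fun i => (if i \in s1 then A1 i else setT) `&`
  (if i \in s2 then A2 i else setT)); split.
- by move=> i /=; rewrite mem_cat => /orP[/s1J|/s2J].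
- by move=> i; apply: measurableI; case: ifP.
apply/seteqP; split => [t [H1 H2] i /= _|t H].
  split; case: ifP => // h; [exact: H1|exact: H2].
split=> i /= h; have := H i; rewrite /= mem_cat h ?orbT => /(_ isT)[];
  by rewrite /= ?h.
Qed.

Hypothesis Xindep : mutually_independent X.

(** As [J1] and [J2] are disjoint, the two finite families of indices concatenate
into a duplicate-free one, to which the product rule applies. *)
Lemma cylinder_indep (J1 J2 : set I) E F : J1 `&` J2 = set0 ->
  cylinder J1 E -> cylinder J2 F -> P (E `&` F) = (P E * P F)%E.
Proof.
move=> J12 [s1 [A1 [s1J mA1 ->]]] [s2 [A2 [s2J mA2 ->]]].
have undupE (s : seq I) A : \bigcap_(i in [set` s]) (X i @^-1` A i) =
    \bigcap_(i in [set` undup s]) (X i @^-1` A i) :> set Th.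
  by congr bigcap; apply/seteqP; split=> i /=; rewrite mem_undup.
rewrite (undupE s1) (undupE s2).
have dis i : i \in undup s1 -> i \notin undup s2.
  rewrite !mem_undup => i1; apply/negP => i2.
  have : (J1 `&` J2) i by split; [exact: s1J|exact: s2J].
  by rewrite J12.
pose A i := if i \in undup s1 then A1 i else A2 i.
have mA i : measurable (A i) by rewrite /A; case: ifP.
have U : uniq (undup s1 ++ undup s2).
  rewrite cat_uniq !undup_uniq/= andbT.
  by apply/hasPn => i i2; apply/negP => /dis; rewrite i2.
have SE : \bigcap_(i in [set` undup s1 ++ undup s2]) (X i @^-1` A i) =
    (\bigcap_(i in [set` undup s1]) (X i @^-1` A1 i)) `&`
    (\bigcap_(i in [set` undup s2]) (X i @^-1` A2 i)) :> set Th.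
  apply/seteqP; split => [t H|t [H1 H2] i /=].
    split=> i /= h; have := H i; rewrite /= mem_cat h ?orbT => /(_ isT);
      rewrite /A ?h//.
    by case: ifPn => // /dis; rewrite h.
  rewrite mem_cat /A; case: ifPn => [h _|_ /= h]; [exact: H1|exact: H2].
have := Xindep U mA; rewrite SE big_cat/= => ->; congr (_ * _)%E.
  rewrite (Xindep (undup_uniq s1) mA1) [LHS]big_seq [RHS]big_seq.
  by apply: eq_bigr => i h; rewrite /A h.
rewrite (Xindep (undup_uniq s2) mA2) [LHS]big_seq [RHS]big_seq.
by apply: eq_bigr => i h; rewrite /A; case: ifPn => // /dis; rewrite h.
Qed.

(** The information carried by the variables indexed by [J]. *)
Definition history (J : set I) : set (set Th) := <<s cylinder J >>.

Lemma history_measurable J : history J `<=` measurable.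
Proof.
apply: smallest_sub; first exact: sigma_algebra_measurable.
exact: cylinder_measurable.
Qed.

(** Both sides are finite measures in [F], hence agree on a sigma-algebra as soon
as they agree on a pi-system that generates it. *)
Lemma indep_of_generators (C : set (set Th)) E :
  C `<=` measurable -> setI_closed C -> C setT -> measurable E ->
  (forall F, C F -> P (E `&` F) = (P E * P F)%E) ->
  forall F, <<s C >> F -> P (E `&` F) = (P E * P F)%E.
Proof.
move=> Cm CI CT mE CE F sF.
have finE : P E \is a fin_num by exact: fin_num_measure.
pose p : {nonneg R} := NngNum (fine_ge0 (measure_ge0 P E)).
have pE G : mscale p P G = (P E * P G)%E by rewrite /mscale /= fineK.
have rE G : mrestr P mE G = P (E `&` G) by rewrite /mrestr setIC.
rewrite -rE -pE.
have CD G : [set Z | C Z /\ Z `<=` setT] G -> C G by case.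
have CDE : [set Z | C Z /\ Z `<=` setT] = C.
  by apply/seteqP; split=> // Z [].
apply: (g_sigma_algebra_measure_unique_trace C setT measurableT) => //=.
- by rewrite CDE.
- by rewrite CDE.
- by rewrite pE rE CE.
- by move=> G /CD CG; rewrite pE rE CE.
- by rewrite rE setIT ltey_eq finE.
- by rewrite CDE.
Qed.

(** The passage from the pi-system to the sigma-algebra is made in one factor at a
time. *)
Lemma history_indep J1 J2 E F : J1 `&` J2 = set0 ->
  history J1 E -> history J2 F -> P (E `&` F) = (P E * P F)%E.
Proof.
move=> J12 hE hF; apply: (@indep_of_generators (cylinder J2)) => //.
- exact: cylinder_measurable.
- exact: cylinderI.
- exact: cylinderT.
- exact: history_measurable hE.
move=> {hF}F cF; rewrite setIC muleC.
apply: (@indep_of_generators (cylinder J1)) => //.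
- exact: cylinder_measurable.
- exact: cylinderI.
- exact: cylinderT.
- exact: cylinder_measurable cF.
by move=> G cG; rewrite setIC muleC; exact: cylinder_indep J12 cG cF.
Qed.

End Independence.

Section ProductExpectation.
Context (d : measure_display) (Th : measurableType d) (R : realType)
  (P : probability Th R).

Lemma integrable_bounded (f : Th -> R) (c : R) : measurable_fun setT f ->
  (forall t, `|f t| <= c) -> P.-integrable setT (EFin \o f).
Proof.
move=> mf fc; apply: measurable_bounded_integrable => //.
  exact: le_lt_trans (probability_le1 P measurableT) (ltry 1).
exists c; split; first exact: num_real.
by move=> M cM t _; exact: le_trans (fc t) (ltW cM).
Qed.

(** Independence means that the joint law of [f] and [g] is the product of their
laws, so the integral of the product splits by Fubini's theorem.  Boundedness
makes every function involved integrable. *)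
Lemma Rintegral_mul_indep (f g : Th -> R) (c : R) :
  measurable_fun setT f -> measurable_fun setT g ->
  (forall t, `|f t| <= c) -> (forall t, `|g t| <= c) ->
  (forall A B, measurable A -> measurable B ->
    P (f @^-1` A `&` g @^-1` B) = (P (f @^-1` A) * P (g @^-1` B))%E) ->
  \int[P]_t (f t * g t) = (\int[P]_t f t) * (\int[P]_t g t).
Proof.
move=> mf mg fc gc fg.
pose X : {RV P >-> R} := mfun_Sub (mem_set mf).
pose Y : {RV P >-> R} := mfun_Sub (mem_set mg).
have mfg : measurable_fun setT
  (fun t => (f t, g t)).
  exact: measurable_fun_pair.
pose XY : {RV P >-> (R * R)%type} :=
  mfun_Sub (mem_set mfg).
have XYE S : measurable S ->
    (distribution P X \x distribution P Y)%E S = distribution P XY S.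
  apply: product_measure_unique => A B mA mB /=.
  by rewrite /distribution /pushforward -fg.
have mh : measurable_fun setT (fun z : R * R => z.1 * z.2).
  by apply: measurable_funM.
have meh := (measurable_EFinP setT _).2 mh.
have ifg : P.-integrable setT (EFin \o (fun t => f t * g t)).
  apply: (@integrable_bounded _ (c * c)) => [|t]; first exact: measurable_funM.
  by rewrite normrM ler_pM.
have ih : (distribution P XY).-integrable setT (EFin \o (fun z => z.1 * z.2)).
  by apply: (integrable_pushforward mfg).
have ihp : (distribution P X \x distribution P Y)%E.-integrable setT
    (EFin \o (fun z => z.1 * z.2)).
  move/integrableP : ih => [_ ih]; apply/integrableP; split => //.
  by rewrite (eq_measure_integral (distribution P XY)) // => A mA _; exact: XYE.
have iX : P.-integrable setT (EFin \o f) by exact: integrable_bounded mf fc.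
have iY : P.-integrable setT (EFin \o g) by exact: integrable_bounded mg gc.
have := integral12_prod_meas1 ihp.
rewrite [RHS](eq_measure_integral (distribution P XY)); last first.
  by move=> A mA _; exact: XYE.
have -> : fubini_F (distribution P Y) (EFin \o (fun z : R * R => z.1 * z.2)) =
    EFin \o (fun x => x * \int[P]_t g t).
  apply/funext => x; rewrite /fubini_F /=.
  rewrite (@integral_distribution _ _ _ _ _ _ Y (fun y => (x * y)%:E)).
  - under eq_integral do rewrite /= EFinM.
    by rewrite integralZl//= EFinM /Rintegral fineK//; exact: integrable_fin_num.
  - by apply/measurable_EFinP; exact: measurable_funM.
  - apply: (@integrable_bounded (fun t => x * g t) (`|x| * c)).
      exact: measurable_funM.
    by move=> t; rewrite normrM ler_wpM2l.
rewrite integral_distribution//=; last 2 first.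
- by apply/measurable_EFinP; exact: measurable_funM.
- apply: (@integrable_bounded (fun t => f t * \int[P]_t g t)
    (c * `|\int[P]_t g t|)); first exact: measurable_funM.
  by move=> t; rewrite normrM ler_wpM2r.
rewrite (integral_distribution (X := XY))//= => H.
by rewrite -RintegralZr// {1}/Rintegral -H.
Qed.
End ProductExpectation.

(** * Bounded functions of a subfamily *)

Section BoundedObservables.
Context (d : measure_display) (Th : measurableType d) (R : realType)
  (P : probability Th R) (I : choiceType) (d' : measure_display)
  (T : measurableType d') (X : I -> {RV P >-> T}).
Implicit Types (J : set I) (f g : Th -> R).

(** Bounded functions determined by the variables indexed by [J].  Masses are of
this kind, since they depend on finitely many letters with heights in [0, 1];
working inside this class settles measurability and integrability at once. *)
Definition observable J f : Prop :=
  measurable_fun [set: g_sigma_algebraType (cylinder X J)] f /\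
  exists c, forall t, `|f t| <= c.

Lemma cylinder_mono J J' : J `<=` J' -> cylinder X J `<=` cylinder X J'.
Proof.
move=> JJ' E [s [A [sJ mA ->]]]; exists s, A.
by split => //; apply: subset_trans JJ'.
Qed.

Lemma history_mono J J' : J `<=` J' -> history X J `<=` history X J'.
Proof. by move=> JJ'; apply: sub_sigma_algebra2; exact: cylinder_mono. Qed.

Lemma observable_mono J J' f : J `<=` J' -> observable J f -> observable J' f.
Proof.
move=> JJ' [mf bf]; split => // _ B mB; apply: (history_mono JJ').
exact: (mf measurableT B mB).
Qed.

Lemma observable_cst J (c : R) : observable J (fun=> c).
Proof. by split; [exact: measurable_cst|exists `|c|]. Qed.

Lemma observableD J f g :
  observable J f -> observable J g -> observable J (fun t => f t + g t).
Proof.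
move=> [mf [c fc]] [mg [e ge]]; split; first exact: measurable_funD.
by exists (c + e) => t; rewrite (le_trans (ler_normD _ _))// lerD.
Qed.

Lemma observableM J f g :
  observable J f -> observable J g -> observable J (fun t => f t * g t).
Proof.
move=> [mf [c fc]] [mg [e ge]]; split; first exact: measurable_funM.
by exists (c * e) => t; rewrite normrM ler_pM.
Qed.

Lemma observableB J f g :
  observable J f -> observable J g -> observable J (fun t => f t - g t).
Proof.
move=> [mf [c fc]] [mg [e ge]]; split; first exact: measurable_funB.
by exists (c + e) => t; rewrite (le_trans (ler_normB _ _))// lerD.
Qed.

Lemma observable_norm J f : observable J f -> observable J (fun t => `|f t|).
Proof.
move=> [mf [c fc]]; split; last by exists c => t; rewrite normr_id.
exact: measurableT_comp.
Qed.

Lemma observable_sum J (K : Type) (s : seq K) (F : K -> Th -> R) :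
  (forall k, observable J (F k)) -> observable J (fun t => \sum_(k <- s) F k t).
Proof.
move=> H; elim: s => [|k s IH].
  by under eq_fun do rewrite big_nil; exact: observable_cst.
by under eq_fun do rewrite big_cons; exact: observableD.
Qed.

Lemma observable_measurable J f : observable J f -> measurable_fun [set: Th] f.
Proof.
move=> [mf _] _ B mB; apply: (@history_measurable _ _ _ _ _ _ _ X J).
exact: (mf measurableT B mB).
Qed.

Lemma observable_integrable J f :
  observable J f -> P.-integrable setT (EFin \o f).
Proof.
move=> of_; have mf := observable_measurable of_; case: of_ => _ [c fc].
exact: integrable_bounded mf fc.
Qed.

Lemma Rintegral_cst1 (c : R) : \int[P]_(_ in setT) c = c.
Proof.
have PT : P setT = 1%E := probability_setT P.
rewrite Rintegral_cst// -[RHS]mulr1; congr (_ * _); exact: (congr1 fine PT).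
Qed.

Lemma Rintegral_sum_observable J (K : Type) (s : seq K) (F : K -> Th -> R) :
  (forall k, observable J (F k)) ->
  \int[P]_t (\sum_(k <- s) F k t) = \sum_(k <- s) \int[P]_t F k t.
Proof.
move=> H; elim: s => [|k s IH].
  rewrite big_nil; under eq_Rintegral do rewrite big_nil.
  by rewrite Rintegral_cst1.
rewrite big_cons -IH; under eq_Rintegral do rewrite big_cons.
rewrite RintegralD//; apply: observable_integrable (J) _ _ => //.
exact: observable_sum.
Qed.

Hypothesis Xindep : mutually_independent X.

Lemma Rintegral_observableM J1 J2 f g : J1 `&` J2 = set0 ->
  observable J1 f -> observable J2 g ->
  \int[P]_t (f t * g t) = (\int[P]_t f t) * (\int[P]_t g t).
Proof.
move=> J12 of_ og; have mf := observable_measurable of_.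
have mg := observable_measurable og.
case: of_ => [m1 [c fc]]; case: og => [m2 [e ge]].
apply: (@Rintegral_mul_indep _ _ _ _ f g (Num.max c e)) => //.
- by move=> t; rewrite le_max fc.
- by move=> t; rewrite le_max ge orbT.
move=> A B mA mB; apply: (history_indep Xindep J12).
- by have := m1 measurableT A mA; rewrite setTI.
- by have := m2 measurableT B mB; rewrite setTI.
Qed.

Lemma Rintegral_sqr_sum J (n : nat) (F : 'I_n -> Th -> R) :
  (forall i, observable J (F i)) ->
  (forall i j, i != j -> \int[P]_t (F i t * F j t) = 0) ->
  \int[P]_t (\sum_i F i t) ^+ 2 = \sum_i \int[P]_t (F i t) ^+ 2.
Proof.
move=> oF orth.
under eq_Rintegral => t _.
  rewrite expr2 mulr_suml; under eq_bigr => i _ do rewrite mulr_sumr.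
  over.
rewrite (@Rintegral_sum_observable J); last first.
  by move=> i; apply: observable_sum => j; exact: observableM.
apply: eq_bigr => i _.
rewrite (@Rintegral_sum_observable J); last by move=> j; exact: observableM.
rewrite (bigD1 i)//= big1 ?addr0// => j ji; apply: orth.
by rewrite eq_sym.
Qed.

End BoundedObservables.

(** * Stopped words and their masses *)

Section Words.
Variables (R : realType) (m : nat) (b : nat -> R).
Implicit Types (y : seq 'I_m -> nat -> R) (u v w : seq 'I_m) (i : 'I_m).

Definition width (k : nat) : R := b k.+1 - b k.

Definition widthw w : R := \prod_(i <- w) width i.

Definition height y u (k : nat) : R := `|y u k.+1 - y u k|.

(** The letters of [w] are read in the subtree hanging at [u], so that this is the
height of the rectangle of [u ++ w] relative to that of [u]. *)
Fixpoint heightw y u w : R :=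
  if w is i :: w' then height y u i * heightw y (rcons u i) w' else 1.

(** Words stopped as soon as their column is no wider than [delta], and at length
[n] at the latest.  The cap [n] makes the recursion structural; by
[cutset_widthw_le] it does no harm when words of length [n] are narrow. *)
Fixpoint cutset (n : nat) (delta : R) : seq (seq 'I_m) :=
  if n is n'.+1 then
    if 1 <= delta then [:: [::]] else
    flatten [seq [seq i :: w | w <- cutset n' (delta / width i)] | i <- enum 'I_m]
  else [:: [::]].

(** The exponent [p = s - 1] gives a mass of constant mean; the exponent 0 gives the
sum of the heights, which governs the number of squares and does not decrease
under refinement.  The two are comparable up to a power of [delta], by
[mass_le_mass0] and [mass0_le_mass]. *)
Definition mass y (p : R) (n : nat) (delta : R) u : R :=
  \sum_(w <- cutset n delta) heightw y u w * widthw w `^ p.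

Lemma cutset_ge1 n delta : 1 <= delta -> cutset n delta = [:: [::]].
Proof. by case: n => //= n ->. Qed.

Lemma widthw_cons i w : widthw (i :: w) = width i * widthw w.
Proof. by rewrite /widthw big_cons. Qed.

Lemma sum_cutsetS (V : nmodType) n delta (f : seq 'I_m -> V) : delta < 1 ->
  \sum_(w <- cutset n.+1 delta) f w =
  \sum_(i < m) \sum_(w <- cutset n (delta / width i)) f (i :: w).
Proof.
move=> d1 /=; rewrite leNgt d1 /= big_flatten /= big_map big_enum /=.
by apply: eq_bigr => i _; rewrite big_map.
Qed.

Lemma mem_cutsetS n delta w : delta < 1 -> w \in cutset n.+1 delta ->
  exists i w', w = i :: w' /\ w' \in cutset n (delta / width i).
Proof.
move=> d1 /=; rewrite leNgt d1 /= => /flatten_mapP[i _ /mapP[w' w'C ->]].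
by exists i, w'.
Qed.

Lemma mass_ge1 y p n delta u : 1 <= delta -> mass y p n delta u = 1.
Proof.
by move=> h; rewrite /mass cutset_ge1// big_seq1 /= /widthw big_nil powR1 mulr1.
Qed.

Lemma mass_n0 y p delta u : mass y p 0 delta u = 1.
Proof. by rewrite /mass big_seq1 /= /widthw big_nil powR1 mulr1. Qed.

Lemma height_ge0 y u k : 0 <= height y u k.
Proof. exact: normr_ge0. Qed.
Hint Resolve height_ge0 : core.

Lemma heightw_ge0 y u w : 0 <= heightw y u w.
Proof. by elim: w u => //= i w IH u; rewrite mulr_ge0. Qed.

Lemma mass_ge0 y p n delta u : 0 <= mass y p n delta u.
Proof. by apply: sumr_ge0 => w _; rewrite mulr_ge0 ?heightw_ge0 ?powR_ge0. Qed.

Lemma cutset_prefix n delta w : (n <= size w)%N ->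
  exists v v', v \in cutset n delta /\ w = v ++ v'.
Proof.
elim: n delta w => [|n IH] delta w nw; first by exists [::], w; rewrite inE.
have [d1|d1] := leP 1 delta.
  by exists [::], w; rewrite cutset_ge1// inE.
case: w nw => //= i w nw; have [v [v' [vC ->]]] := IH (delta / width i) w nw.
exists (i :: v), v'; split => //=; rewrite leNgt d1 /=.
by apply/flatten_mapP; exists i; rewrite ?mem_enum//; apply: map_f.
Qed.

Hypothesis hb : is_partition m b.

Lemma width_gt0 i : 0 < width i.
Proof. by case: hb => _ _ bS; rewrite subr_gt0 bS. Qed.
Hint Resolve width_gt0 : core.

Lemma width_ge0 i : 0 <= width i. Proof. exact: ltW. Qed.
Hint Resolve width_ge0 : core.

Lemma widthw_gt0 w : 0 < widthw w.
Proof. by apply: prodr_gt0 => i _. Qed.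

Lemma sum_ord_telescope (V : zmodType) (f : nat -> V) :
  \sum_(i < m) (f i.+1 - f i) = f m - f 0%N.
Proof.
by rewrite -(big_mkord xpredT (fun k => f k.+1 - f k)) telescope_sumr.
Qed.

Lemma sum_width : \sum_(i < m) width i = 1.
Proof. by rewrite sum_ord_telescope; case: hb => -> -> _; rewrite subr0. Qed.

Lemma width_le1 i : width i <= 1.
Proof. by rewrite -sum_width (bigD1 i)//= lerDl sumr_ge0. Qed.

Lemma widthw_le1 w : widthw w <= 1.
Proof.
elim: w => [|i w IH]; first by rewrite /widthw big_nil.
by rewrite widthw_cons mulr_ile1 ?width_le1// ltW// widthw_gt0.
Qed.

Lemma massS y p n delta u : delta < 1 ->
  mass y p n.+1 delta u =
  \sum_(i < m) height y u i * width i `^ p * mass y p n (delta / width i) (rcons u i).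
Proof.
move=> d1; rewrite /mass sum_cutsetS//; apply: eq_bigr => i _.
rewrite mulr_sumr; apply: eq_bigr => w _ /=.
by rewrite widthw_cons powRM ?width_ge0// ?(ltW (widthw_gt0 _))//; ring.
Qed.

Section Bounds.
Variable (lo hi : R).
Hypotheses (lo0 : 0 < lo) (loi : forall i, lo <= width i)
           (hi0 : 0 < hi) (hii : forall i, width i <= hi).

(** A word is extended only as long as it is wider than [delta], and one more
letter divides its width by at most [lo^-1]. *)
Lemma cutset_widthw_ge n delta w : lo <= 1 -> 0 < delta <= 1 ->
  w \in cutset n delta ->
  lo * delta <= widthw w.
Proof.
move=> lo1; elim: n delta w => [|n IH] delta w /andP[d0 d1].
  by rewrite inE => /eqP ->; rewrite /widthw big_nil mulr_ile1// ltW.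
have [d1'|d1'] := leP 1 delta.
  by rewrite cutset_ge1// inE => /eqP ->; rewrite /widthw big_nil mulr_ile1// ltW.
case/(mem_cutsetS d1') => i [w' [-> w'C]]; rewrite widthw_cons.
have [h|h] := leP (delta / width i) 1.
  by rewrite [leRHS]mulrC -ler_pdivrMr// -mulrA; apply: IH w'C; rewrite h divr_gt0.
move: w'C; rewrite cutset_ge1 ?(ltW h)// inE => /eqP ->; rewrite /widthw big_nil mulr1.
by apply: le_trans (loi i); rewrite ler_piMr// ltW.
Qed.

(** The only words that could be stopped too early have length [n], and those are
no wider than [hi ^+ n]. *)
Lemma cutset_widthw_le n delta w : hi ^+ n <= delta -> w \in cutset n delta ->
  widthw w <= delta.
Proof.
elim: n delta w => [|n IH] delta w hd.
  by rewrite inE => /eqP ->; rewrite /widthw big_nil.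
have [d1|d1] := leP 1 delta.
  by rewrite cutset_ge1// inE => /eqP ->; rewrite /widthw big_nil.
case/(mem_cutsetS d1) => i [w' [-> w'C]]; rewrite widthw_cons mulrC -ler_pdivlMr//.
apply: IH w'C; rewrite ler_pdivlMr//; apply: le_trans hd.
by rewrite exprSr ler_wpM2l// exprn_ge0// ltW.
Qed.

Lemma mass_le_mass0 y (p : R) n delta u : 0 <= p -> hi ^+ n <= delta ->
  mass y p n delta u <= delta `^ p * mass y 0 n delta u.
Proof.
move=> p0 hd; rewrite /mass mulr_sumr big_seq [leRHS]big_seq.
apply: ler_sum => w wC; rewrite powRr0 mulr1 mulrC ler_wpM2r ?heightw_ge0//.
have dl := cutset_widthw_le hd wC.
have l0 := ltW (widthw_gt0 w).
by rewrite ge0_ler_powR ?nnegrE// (le_trans l0).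
Qed.

Lemma mass0_le_mass y (p : R) n delta u : lo <= 1 -> 0 <= p -> 0 < delta <= 1 ->
  (lo * delta) `^ p * mass y 0 n delta u <= mass y p n delta u.
Proof.
move=> lo1 p0 hd; rewrite /mass mulr_sumr big_seq [leRHS]big_seq.
apply: ler_sum => w wC; rewrite powRr0 mulr1 mulrC ler_wpM2l ?heightw_ge0//.
have dl := cutset_widthw_ge lo1 hd wC.
case/andP : hd => d0 d1.
by rewrite ge0_ler_powR ?nnegrE ?(ltW (widthw_gt0 w))// mulr_ge0// ltW.
Qed.

End Bounds.

Section Heights.
Variable y : seq 'I_m -> nat -> R.
Hypotheses (y0 : forall u, y u 0%N = 0) (ym : forall u, y u m = 1)
  (y01 : forall u k, 0 <= y u k <= 1).

Lemma height_le1 u k : height y u k <= 1.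
Proof.
have := y01 u k; have := y01 u k.+1; rewrite /height ler_norml.
move=> /andP[? ?] /andP[? ?].
by apply/andP; split; lra.
Qed.

(** The signed increments sum to [y u m - y u 0 = 1]. *)
Lemma sum_height_ge1 u : 1 <= \sum_(i < m) height y u i.
Proof.
apply: le_trans (ler_norm_sum _ _ _).
by rewrite sum_ord_telescope ym y0 subr0 normr1.
Qed.

Lemma mass0_ge1 n delta u : 1 <= mass y 0 n delta u.
Proof.
elim: n delta u => [|n IH] delta u; first by rewrite mass_n0.
have [d1|d1] := leP 1 delta; first by rewrite mass_ge1.
rewrite massS//; apply: le_trans (sum_height_ge1 u) _.
by apply: ler_sum => i _; rewrite powRr0 mulr1 ler_peMr.
Qed.

(** By [sum_height_ge1], splitting a word replaces its height by a sum which is at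
least as large. *)
Lemma mass0_refine n n' delta delta' u : (n <= n')%N -> delta' <= delta ->
  mass y 0 n delta u <= mass y 0 n' delta' u.
Proof.
elim: n n' delta delta' u => [|n IH] [|n'] delta delta' u //.
  by rewrite mass_n0 mass0_ge1.
move=> nn' dd; have [d1|d1] := leP 1 delta.
  by rewrite (@mass_ge1 _ _ _ delta)// mass0_ge1.
rewrite !massS// ?(le_lt_trans dd)//; apply: ler_sum => i _.
by rewrite ler_wpM2l ?mulr_ge0 ?powR_ge0// IH// ler_wpM2r// invr_ge0.
Qed.

Lemma heightw_le1 u w : heightw y u w <= 1.
Proof. by elim: w u => //= i w IH u; rewrite mulr_ile1 ?height_le1 ?heightw_ge0. Qed.

Lemma mass_le_size (p : R) n delta u : 0 <= p ->
  mass y p n delta u <= (size (cutset n delta))%:R.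
Proof.
move=> p0; rewrite -sum1_size natr_sum; apply: ler_sum => w _.
rewrite mulr_ile1 ?heightw_ge0 ?powR_ge0 ?heightw_le1//.
by rewrite powR_le1// widthw_le1 ltW// widthw_gt0.
Qed.

End Heights.
End Words.

(** * Columns of the graph, and a lower bound for coverings *)

(** Lebesgue measure is monotone and subadditive. *)
Lemma interval_cover_length (R : realType) (n : nat) (K : pred 'I_n)
    (x y delta : R) (c : 'I_n -> R) : 0 <= delta ->
  (forall z, x <= z <= y -> exists2 k, K k & c k <= z <= c k + delta) ->
  y - x <= delta * \sum_(k < n) (K k)%:R.
Proof.
move=> d0 cov.
have [yx|xy] := leP y x.
  by apply: (@le_trans _ _ 0); rewrite ?subr_le0// mulr_ge0// sumr_ge0.
pose A k : set R := if K k then [set` `[c k, c k + delta]] else set0.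
have : (lebesgue_measure ([set` `[x, y]] : set R) <=
    \sum_(k \in [set` enum 'I_n]) lebesgue_measure (A k))%E.
  apply: content_sub_fsum => //.
  - by move=> k _; rewrite /A; case: ifP.
  - by move=> z /=; rewrite in_itv/= => /cov[k Kk ck]; exists k;
      rewrite /= ?mem_enum// /A Kk /= in_itv.
rewrite -fsbig_seq ?enum_uniq// big_enum lebesgue_measure_itv/= lte_fin xy -EFinD.
move=> h; rewrite -lee_fin; apply: le_trans h _.
rewrite mulr_sumr -sumEFin; apply: lee_sum => k _; rewrite /A; case: (K k).
  rewrite lebesgue_measure_itv/= mulr1; case: ifP => _; rewrite ?lee_fin//.
  by rewrite addrAC subrr add0r.
by rewrite measure0 mulr0.
Qed.

Section Geometry.
Variables (R : realType) (m : nat) (b : nat -> R).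
Implicit Types (y : seq 'I_m -> nat -> R) (u v w : seq 'I_m) (i : 'I_m).

(** The left end of the column of [w], obtained as the first coordinate of the
image of the origin under the affine map of [w]. *)
Fixpoint leftw w : R := if w is i :: w' then width b i * leftw w' + b i else 0.

(** The signed version of [heightw]: the affine map of [w] acts on the second
coordinate as [q |-> slopew * q + basew]. *)
Fixpoint slopew y u w : R :=
  if w is i :: w' then (y u i.+1 - y u i) * slopew y (rcons u i) w' else 1.

Fixpoint basew y u w : R :=
  if w is i :: w' then
    (y u i.+1 - y u i) * basew y (rcons u i) w' + y u i
  else 0.

Lemma normr_slopew y u w : `|slopew y u w| = heightw y u w.
Proof. by elim: w u => [|i w IH] u /=; rewrite ?normr1// normrM IH. Qed.

Lemma affine_compE y u w (p : R * R) : affine_comp b y u w p =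
  (widthw b w * p.1 + leftw w, slopew y u w * p.2 + basew y u w).
Proof.
elim: w u => [|i w IH] u /=.
  by rewrite /widthw big_nil !mul1r !addr0; case: p.
by rewrite IH /affine_map /= widthw_cons /width; congr pair; ring.
Qed.

Lemma affine_comp_cat y u v w (p : R * R) :
  affine_comp b y u (v ++ w) p =
  affine_comp b y u v (affine_comp b y (u ++ v) w p).
Proof.
elim: v u => [|i v IH] u /=; first by rewrite cats0.
by rewrite IH cat_rcons.
Qed.

(** The columns of the stopped words tile [0, 1], so that the increments of any
function over them add up.  The identity gives the total width, and truncated
identities give the total width of the columns in a given interval. *)
Lemma sum_cutset_telescope (V : zmodType) n delta (phi : R -> V) :
  is_partition m b ->
  \sum_(w <- cutset m b n delta) (phi (leftw w + widthw b w) - phi (leftw w)) =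
  phi 1 - phi 0.
Proof.
move=> hb; elim: n delta phi => [|n IH] delta phi.
  by rewrite big_seq1 /= /widthw big_nil add0r.
have [d1|d1] := leP 1 delta.
  by rewrite cutset_ge1// big_seq1 /= /widthw big_nil add0r.
rewrite sum_cutsetS//; under eq_bigr => i _.
  rewrite (eq_bigr (fun w => phi (width b i * (leftw w + widthw b w) + b i) -
    phi (width b i * leftw w + b i))); last first.
    by move=> w _; rewrite /= widthw_cons; congr (phi _ - phi _); ring.
  rewrite (IH _ (fun x => phi (width b i * x + b i))) mulr1 mulr0 add0r /width subrK.
  over.
by rewrite (sum_ord_telescope m (fun k => phi (b k))); case: hb => -> -> _.
Qed.

Lemma sum_cutset_widthw n delta : is_partition m b ->
  \sum_(w <- cutset m b n delta) widthw b w = 1.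
Proof.
move=> hb; rewrite -[RHS]subr0 -(sum_cutset_telescope n delta idfun hb).
by apply: eq_bigr => w _ /=; rewrite addrC addKr.
Qed.

Variable y : seq 'I_m -> nat -> R.
Hypotheses (hb : is_partition m b) (y01 : forall u k, 0 <= y u k <= 1).

Lemma b_ge0 k : (k <= m)%N -> 0 <= b k.
Proof.
case: hb => b0 _ bS; elim: k => [|k IH] km; first by rewrite b0.
exact: le_trans (IH (ltnW km)) (ltW (bS _ km)).
Qed.

Lemma b_le1 k : (k <= m)%N -> b k <= 1.
Proof.
case: hb => _ bm bS km; rewrite -subr_ge0 -bm -telescope_sumr// big_nat.
by apply: sumr_ge0 => i /andP[_ im]; rewrite subr_ge0 ltW// bS.
Qed.

Lemma affine_comp_square u w (p : R * R) :
  unit_square p -> unit_square (affine_comp b y u w p).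
Proof.
elim: w u => //= i w IH u /(IH (rcons u i)).
move: (affine_comp _ _ _ _ _) => -[q1 q2] [] /=; rewrite !in_itv /= => q1i q2i.
split; rewrite /= in_itv/=.
  have := ltW (width_gt0 hb i); rewrite -/(width b i) => l0.
  have h0 := b_ge0 (ltnW (ltn_ord i)); have h1 := b_le1 (ltn_ord i).
  have bE : b i.+1 = width b i + b i by rewrite /width subrK.
  have : 0 <= width b i * q1 <= width b i.
    by rewrite mulr_ge0 ?ler_piMr//; case/andP: q1i.
  by move=> /andP[? ?]; apply/andP; split; lra.
have := y01 u i; have := y01 u i.+1; nra.
Qed.

Lemma rectangle_cat v w : rectangle b y (v ++ w) `<=` rectangle b y v.
Proof.
move=> _ [p sp <-]; rewrite affine_comp_cat.
by exists (affine_comp b y ([::] ++ v) w p) => //; exact: affine_comp_square.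
Qed.

(** When the letter [i] is appended to [w] again and again, the image of its fixed
point [p] does not move, hence lies in the rectangles of all prefixes of the
infinite word thus obtained. *)
Lemma limit_set_fixed_corner i (p : R * R) w : unit_square p ->
  (forall u, affine_map b y u i p = p) ->
  limit_set b y (affine_comp b y [::] w p).
Proof.
move=> sp fp n n0.
pose v := w ++ nseq n i; exists (take n v) => /=.
  by rewrite size_takel// size_cat size_nseq leq_addl.
have -> : affine_comp b y [::] w p = affine_comp b y [::] v p.
  rewrite /v affine_comp_cat; congr affine_comp.
  by elim: {v n0}n ([::] ++ w) => //= n IH u; rewrite -IH fp.
by apply: (@rectangle_cat _ (drop n v)); rewrite cat_take_drop; exists p.
Qed.

Hypotheses (y0 : forall u, y u 0%N = 0) (ym : forall u, y u m = 1)
  (m0 : (0 < m)%N).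

(** The first letter always fixes the corner (0, 0). *)
Lemma limit_set_left w : limit_set b y (leftw w, basew y [::] w).
Proof.
have := @limit_set_fixed_corner (Ordinal m0) (0, 0) w.
rewrite affine_compE /= !mulr0 !add0r; apply.
  by split; rewrite /= in_itv/= lexx ler01.
by case: hb => b0 _ _ u; rewrite /affine_map /= y0 b0 !mulr0 !addr0.
Qed.

(** The last letter always fixes the corner (1, 1). *)
Lemma limit_set_right w : limit_set b y
  (leftw w + widthw b w, basew y [::] w + slopew y [::] w).
Proof.
have lm : (m.-1 < m)%N by rewrite ltn_predL.
have := @limit_set_fixed_corner (Ordinal lm) (1, 1) w.
rewrite affine_compE /= !mulr1 [widthw b w + _]addrC [slopew _ _ _ + _]addrC.
apply; first by split; rewrite /= in_itv/= lexx ler01.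
case: hb => _ bm _ u; rewrite /affine_map /= !mulr1 prednK// ym bm.
by rewrite !subrK.
Qed.

Lemma leftw_ge0 w : 0 <= leftw w.
Proof.
elim: w => //= i w IH; rewrite addr_ge0 ?mulr_ge0 ?width_ge0//.
exact/b_ge0/ltnW/ltn_ord.
Qed.

Lemma rightw_le1 w : leftw w + widthw b w <= 1.
Proof.
elim: w => [|i w IH] /=; first by rewrite /widthw big_nil add0r.
have -> : width b i * leftw w + b i + widthw b (i :: w) =
  width b i * (leftw w + widthw b w) + b i by rewrite widthw_cons; ring.
apply: le_trans (b_le1 (ltn_ord i)).
by rewrite -lerBrDr -/(width b i) ler_piMr// width_ge0.
Qed.

Section Graph.
Variable f : R -> R.
Hypotheses (fcont : {within `[0, 1], continuous f})
  (fgraph : limit_set b y = graph01 f).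

(** The graph joins two opposite corners of the rectangle of [w], so by the
intermediate value theorem it takes over the column all the values in an
interval of length [heightw w], and the vertical sides of the squares that meet
the column cover this interval. *)
Lemma heightw_le_cover n (c : 'I_n -> R * R) (delta : R) w : 0 <= delta ->
  graph01 f `<=` \bigcup_k square (c k) delta ->
  heightw y [::] w <= delta * \sum_(k < n)
    ((c k).1 <= leftw w + widthw b w <= (c k).1 + delta + widthw b w)%R%:R.
Proof.
move=> d0 cov.
have lw := ltW (widthw_gt0 hb w).
have fl : f (leftw w) = basew y [::] w.
  by have := limit_set_left w; rewrite fgraph => -[].
have fr : f (leftw w + widthw b w) = basew y [::] w + slopew y [::] w.
  by have := limit_set_right w; rewrite fgraph => -[].
have [lo hi] : 0 <= leftw w /\ leftw w + widthw b w <= 1.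
  by rewrite leftw_ge0 rightw_le1.
pose p := Num.min (f (leftw w)) (f (leftw w + widthw b w)).
pose q := Num.max (f (leftw w)) (f (leftw w + widthw b w)).
have -> : heightw y [::] w = q - p.
  by rewrite -normr_slopew /q /p fr fl; case: (leP 0 (slopew y [::] w)) => s0;
   [rewrite ger0_norm// max_r ?min_l ?lerDl//
   |rewrite ltr0_norm// max_l ?min_r ?gerDl ?(ltW s0)//]; ring.
apply: (@interval_cover_length _ _ _ _ _ _ (fun k => (c k).2)) => // z zpq.
have fcw : {within `[leftw w, leftw w + widthw b w], continuous f}.
  apply: continuous_subspaceW fcont => x /=; rewrite !in_itv /= => /andP[? ?].
  by apply/andP; split; lra.
have lew : leftw w <= leftw w + widthw b w by rewrite lerDl.
have [x + fx] := IVT lew fcw zpq; rewrite in_itv /= => /andP[xl xr].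
have : graph01 f (x, z).
  by split => //=; rewrite in_itv/=; apply/andP; split; lra.
move/cov => [k _ []] /=; rewrite !in_itv/= => /andP[? ?] zk.
by exists k => //; apply/andP; split; lra.
Qed.

(** A column no wider than [delta] which meets [[x, x + delta]] is contained in
[[x - delta, x + 2 * delta]].  As columns do not overlap and have width at least
[lo * delta], there are at most [3 / lo] of them. *)
Lemma sum_meets_le N (x delta lo : R) : 0 < lo -> 0 < delta ->
  (forall w, w \in cutset m b N delta -> lo * delta <= widthw b w <= delta) ->
  \sum_(w <- cutset m b N delta)
    ((x <= leftw w + widthw b w <= x + delta + widthw b w)%R%:R : R) <= 3 / lo.
Proof.
move=> lo0 d0 H.
(* The identity truncated to [x - delta, x + 2 * delta]. *)
pose phi t := Num.max (x - delta) (Num.min t (x + delta + delta)).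
have phi_mono t t' : t <= t' -> phi t <= phi t'.
  move=> tt'; rewrite /phi ge_max !le_max lexx /= le_min !ge_min lexx tt'.
  by rewrite !orbT.
have phiB t t' : phi t' - phi t <= 3 * delta.
  have : phi t' <= x + delta + delta.
    by rewrite /phi ge_max ge_min lexx orbT andbT; lra.
  have : x - delta <= phi t by rewrite /phi le_max lexx.
  by lra.
rewrite ler_pdivlMr// -(ler_pM2r d0); apply: le_trans (phiB 0 1).
rewrite -(sum_cutset_telescope N delta phi hb) -mulrA mulr_suml.
rewrite big_seq [leRHS]big_seq; apply: ler_sum => w /H /andP[wl wr].
have lw := ltW (widthw_gt0 hb w).
case: (boolP (_ <= _ <= _)) => [/andP[h1 h2]|_]; last first.
  by rewrite mul0r subr_ge0 phi_mono// lerDl.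
have phiE t : x - delta <= t <= x + delta + delta -> phi t = t.
  by case/andP=> ? ?; rewrite /phi min_l// max_r.
by rewrite mul1r !phiE; lra.
Qed.

(** The incidences between squares and columns are counted twice: from the columns
by [heightw_le_cover], and from the squares by [sum_meets_le]. *)
Lemma coverable_graph_ge n N (delta lo : R) : 0 < lo -> 0 < delta ->
  (forall w, w \in cutset m b N delta -> lo * delta <= widthw b w <= delta) ->
  coverable (graph01 f) delta n ->
  lo * mass b y 0 N delta [::] <= 3 * delta * n%:R.
Proof.
move=> lo0 d0 H [c cov].
rewrite mulrC -ler_pdivlMr//.
have -> : 3 * delta * n%:R / lo = delta * \sum_(k < n) (3 / lo).
  by rewrite sumr_const card_ord -mulr_natr; ring.
apply: le_trans (_ : delta * \sum_(k < n) \sum_(w <- cutset m b N delta)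
  ((c k).1 <= leftw w + widthw b w <= (c k).1 + delta + widthw b w)%R%:R <= _);
  last first.
  by rewrite ler_wpM2l ?(ltW d0)//; apply: ler_sum => k _; exact: sum_meets_le.
rewrite exchange_big mulr_sumr; apply: ler_sum => w _.
by rewrite powRr0 mulr1; apply: heightw_le_cover => //; exact: ltW.
Qed.

End Graph.
End Geometry.

(** * Coverings by squares and box dimension *)

Section Coverings.
Variable R : realType.
Implicit Types (E : set (R * R)) (delta : R).

Lemma coverable_seqP E delta n : coverable E delta n <->
  exists2 s : seq (R * R), size s = n &
    forall p, E p -> exists2 c, c \in s & square c delta p.
Proof.
split=> [[c Ec]|[s sn Es]].
  exists [seq c k | k <- enum 'I_n]; first by rewrite size_map size_enum_ord.
  by move=> p /Ec[k _ ck]; exists (c k) => //; apply: map_f; rewrite mem_enum.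
exists (fun k => nth (0, 0) s k) => p /Es[c /(nthP (0, 0))[k ks <-] pc].
by rewrite sn in ks; exists (Ordinal ks).
Qed.

Lemma sub_coverable E E' delta n :
  E `<=` E' -> coverable E' delta n -> coverable E delta n.
Proof. by move=> EE' [c Ec]; exists c; exact: subset_trans EE' Ec. Qed.

Lemma coverable_widen E delta delta' n :
  delta <= delta' -> coverable E delta n -> coverable E delta' n.
Proof.
move=> dd' [c Ec]; exists c => p /Ec[k _ []]; rewrite /= !in_itv/=.
by move=> /andP[? ?] /andP[? ?]; exists k => //; split; rewrite /= in_itv/=;
  apply/andP; split; lra.
Qed.

Lemma coverable_bigcup (T : eqType) (s : seq T) (F : T -> set (R * R)) delta
    (n : T -> nat) : (forall x, x \in s -> coverable (F x) delta (n x)) ->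
  coverable (\bigcup_(x in [set` s]) F x) delta (\sum_(x <- s) n x).
Proof.
move=> H; apply/coverable_seqP; elim: s H => [|x s IH] H.
  by exists [::]; rewrite ?big_nil// => p [].
have [|s1 s1n Hs1] := IH; first by move=> z zs; apply: H; rewrite inE zs orbT.
have /coverable_seqP[s2 s2n Hs2] := H _ (mem_head x s).
exists (s2 ++ s1); first by rewrite big_cons size_cat s2n s1n.
move=> p [z /=]; rewrite inE => /predU1P[->|zs] Fp.
  by have [c cs cp] := Hs2 _ Fp; exists c; rewrite // mem_cat cs.
have [|c cs cp] := Hs1 p; first by exists z.
by exists c; rewrite // mem_cat cs orbT.
Qed.

Lemma coverable_strip (x y h delta : R) : 0 < delta -> 0 <= h ->
  coverable (`[x, x + delta] `*` `[y, y + h]) delta (Num.truncn (h / delta)).+1.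
Proof.
move=> d0 h0; exists (fun k => (x, y + delta * k%:R)) => -[p q] [/= px].
rewrite in_itv/= => /andP[q1 q2].
pose k := Num.truncn ((q - y) / delta).
have qy : 0 <= (q - y) / delta by rewrite divr_ge0 ?subr_ge0// ltW.
have kh : (k < (Num.truncn (h / delta)).+1)%N.
  rewrite ltnS /k truncn_ge_nat ?divr_ge0 ?(ltW d0)//.
  have /andP[h1 _] := truncn_itv qy; apply: le_trans h1 _.
  by rewrite ler_wpM2r ?invr_ge0 ?(ltW d0)//; lra.
exists (Ordinal kh) => //; split => //=; rewrite in_itv/=.
have := truncn_itv qy; rewrite -/k ler_pdivlMr// ltr_pdivrMr// -natr1.
by move=> /andP[? ?]; apply/andP; split; lra.
Qed.

Lemma covering_number_spec E delta n : coverable E delta n ->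
  coverable E delta (covering_number E delta) /\ (covering_number E delta <= n)%N.
Proof.
move=> En; have ex : exists k, `[< coverable E delta k >].
  by exists n; apply/asboolP.
suff : coverable E delta (covering_number E delta) /\
    forall k, coverable E delta k -> (covering_number E delta <= k)%N.
  by case=> ? H; split=> //; exact: H.
apply: (@xgetPex _ 0%N [set n | coverable E delta n /\
  forall k, coverable E delta k -> (n <= k)%N]).
exists (ex_minn ex); case: ex_minnP => k /asboolP kE kmin; split => // j jE.
by apply: kmin; apply/asboolP.
Qed.

Section Limits.
Variables (T : choiceType) (X : filteredType T) (F : set_system X).
Hypothesis FF : ProperFilter F.

Lemma limf_esup_eq (g : X -> R) (s : R) :
  (forall e, 0 < e -> F [set x | `|g x - s| <= e]) ->
  limf_esup (fun x => (g x)%:E) F = s%:E.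
Proof.
move=> H; rewrite limf_esupE; apply/eqP; rewrite eq_le; apply/andP; split.
  apply/lee_addgt0Pr => e e0.
  apply: ge_ereal_inf; 
    exists (ereal_sup ((fun x => (g x)%:E) @` [set x | `|g x - s| <= e])).
    by exists [set x | `|g x - s| <= e] => //; exact: H.
  apply: ge_ereal_sup => _ [x /= gx <-]; rewrite -EFinD lee_fin.
  by move: gx; rewrite ler_norml => /andP[? ?]; lra.
apply: le_ereal_inf_tmp => _ [V FV <-].
apply/lee_addgt0Pr => e e0.
have [x [Vx /= gx]] := filter_ex (filterI FV (H e e0)).
apply: (@le_trans _ _ ((g x)%:E + e%:E)%E).
  by rewrite -EFinD lee_fin; move: gx; rewrite ler_norml => /andP[? ?]; lra.
by rewrite leeD2r//; apply: ereal_sup_ubound; exists x.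
Qed.

Lemma limf_einf_eq (g : X -> R) (s : R) :
  (forall e, 0 < e -> F [set x | `|g x - s| <= e]) ->
  limf_einf (fun x => (g x)%:E) F = s%:E.
Proof.
move=> H.
have <- : (- limf_esup (fun x => (- g x)%:E) F = s%:E)%E; last by [].
rewrite (@limf_esup_eq (fun x => - g x) (- s)) ?EFinN ?oppeK// => e e0.
apply: filterS (H e e0) => x /=.
by rewrite (_ : - g x - - s = - (g x - s)) ?normrN//; ring.
Qed.

End Limits.

Lemma expr_bracket (r delta : R) : 0 < r < 1 -> 0 < delta -> delta < 1 ->
  exists k, r ^+ k.+1 <= delta < r ^+ k.
Proof.
move=> /andP[r0 r1] d0 d1.
have ex : exists k, r ^+ k <= delta.
  by apply: exists_small_power => //; rewrite r1 ltW.
case: (ex_minnP ex) => -[|k] h kmin; first by move: h; rewrite expr0 leNgt d1.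
exists k; rewrite h /= ltNge; apply/negP => /kmin; by rewrite ltnn.
Qed.

(** Coverings stay coverings when the side of the squares increases, so the scales
[r ^+ k] control all the others up to a constant factor, and constant factors
disappear in the ratio of logarithms. *)
Lemma is_box_dim_geometric E (r s c1 c2 : R) : 0 < r < 1 -> 0 <= s -> 0 < c1 ->
  (\forall k \near \oo, forall n, coverable E (r ^+ k) n ->
     c1 <= n%:R * (r ^+ k) `^ s) ->
  (\forall k \near \oo, exists2 n, coverable E (r ^+ k) n &
     n%:R * (r ^+ k) `^ s <= c2) ->
  is_box_dim E s.
Proof.
move=> /andP[r0 r1] s0 c10 H1 H2.
have [k0 _ H] : \forall k \near \oo, (forall n, coverable E (r ^+ k) n ->
     c1 <= n%:R * (r ^+ k) `^ s) /\
   (exists2 n, coverable E (r ^+ k) n & n%:R * (r ^+ k) `^ s <= c2).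
  by near=> k; split; near: k.
have rs0 : 0 < r `^ s by exact: powR_gt0.
have bound delta : 0 < delta < r ^+ k0 -> delta < 1 ->
    c1 * r `^ s <= (covering_number E delta)%:R * delta `^ s <= c2 / r `^ s.
  move=> /andP[d0 dk0] d1.
  have [|k /andP[dk1 dk2]] := @expr_bracket r delta _ d0 d1; first by rewrite r0.
  have k0k : (k0 <= k)%N.
    rewrite -ltnS ltnNge; apply/negP => kk0.
    by have := le_lt_trans dk1 dk0; rewrite ltr_iXn2l// ltnNge kk0.
  have rk0 : 0 < r ^+ k by rewrite exprn_gt0.
  have [_ [n nC nc2]] := H k.+1 (leqW k0k).
  have [cC cn] := covering_number_spec (coverable_widen dk1 nC).
  have [/(_ _ (coverable_widen (ltW dk2) cC)) h1 _] := H k k0k.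
  have pE : (r ^+ k.+1) `^ s = r `^ s * (r ^+ k) `^ s.
    by rewrite exprS powRM// ltW.
  apply/andP; split.
    rewrite -ler_pdivlMr//; apply: le_trans h1 _.
    rewrite -mulrA ler_wpM2l// ler_pdivlMr// mulrC -pE.
    by rewrite ge0_ler_powR// nnegrE ltW// exprn_gt0.
  rewrite ler_pdivlMr//; apply: le_trans nc2; rewrite pE -mulrA.
  apply: ler_pM; rewrite ?mulr_ge0 ?powR_ge0 ?ler_nat//.
  rewrite mulrC ler_wpM2l ?powR_ge0// ge0_ler_powR// ?nnegrE ?ltW//.
have lim e : 0 < e -> \forall delta \near 0^'+,
    `|ln (covering_number E delta)%:R / - ln delta - s| <= e.
  move=> e0.
  pose L := `|ln (c1 * r `^ s)| + `|ln (c2 / r `^ s)|.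
  have L0 : 0 <= L by rewrite addr_ge0.
  near=> delta.
  have d0 : 0 < delta by near: delta; exact: nbhs_right_gt.
  have d1 : delta < 1 by near: delta; apply: nbhs_right_lt.
  have dk0 : delta < r ^+ k0.
    by near: delta; apply: nbhs_right_lt; rewrite exprn_gt0.
  have dL : delta < expR (- (L / e)).
    by near: delta; apply: nbhs_right_lt; rewrite expR_gt0.
  have ld : L / e < - ln delta.
    rewrite ltrNr -[ltRHS]expRK.
    by rewrite ltr_ln// ?posrE ?expR_gt0.
  have ld0 : 0 < - ln delta by rewrite (le_lt_trans _ ld)// divr_ge0// ltW.
  have /andP[b1 b2] : c1 * r `^ s <=
      (covering_number E delta)%:R * delta `^ s <= c2 / r `^ s.
    by apply: bound => //; rewrite d0.
  have c1r : 0 < c1 * r `^ s by rewrite mulr_gt0.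
  have X0 := lt_le_trans c1r b1.
  have ds0 : 0 < delta `^ s by rewrite powR_gt0.
  have N0 : 0 < (covering_number E delta)%:R :> R.
    by move: X0; rewrite pmulr_lgt0.
  have l1 : ln (c1 * r `^ s) <= ln ((covering_number E delta)%:R * delta `^ s).
    by rewrite ler_ln.
  have l2 : ln ((covering_number E delta)%:R * delta `^ s) <= ln (c2 / r `^ s).
    by rewrite ler_ln// posrE (lt_le_trans X0 b2).
  rewrite (_ : _ - s = ln ((covering_number E delta)%:R * delta `^ s) / - ln delta);
    last first.
    by rewrite lnM ?posrE// ln_powR; field; rewrite -oppr_eq0 gt_eqF.
  rewrite normrM normfV (gtr0_norm ld0) ler_pdivrMr//.
  apply: (@le_trans _ _ L); last by rewrite mulrC -ler_pdivrMr// ltW.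
  have n1 := ler_norm (ln (c2 / r `^ s)).
  have n2 := ler_norm (- ln (c1 * r `^ s)); rewrite normrN in n2.
  have n3 := normr_ge0 (ln (c2 / r `^ s)).
  have n4 := normr_ge0 (ln (c1 * r `^ s)).
  by rewrite /L ler_norml; apply/andP; split; lra.
by split; [apply: limf_einf_eq|apply: limf_esup_eq].
Unshelve. all: by end_near.
Qed.

End Coverings.

Section GraphUpper.
Variables (R : realType) (m : nat) (b : nat -> R) (y : seq 'I_m -> nat -> R).
Hypotheses (hb : is_partition m b) (y01 : forall u k, 0 <= y u k <= 1).
Implicit Types (w : seq 'I_m).

Lemma rectangle_sub_strip w (delta : R) : widthw b w <= delta ->
  rectangle b y w `<=` `[leftw b w, leftw b w + delta] `*`
    `[Num.min (basew y [::] w) (basew y [::] w + slopew y [::] w),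
      Num.min (basew y [::] w) (basew y [::] w + slopew y [::] w) +
      heightw y [::] w].
Proof.
move=> lwd _ [[p q] [/= pi qi] <-]; rewrite affine_compE /=.
move: pi qi; rewrite !in_itv/= => /andP[p0 p1] /andP[q0 q1].
have l0 := ltW (widthw_gt0 hb w).
have : 0 <= widthw b w * p <= widthw b w by rewrite mulr_ge0 ?ler_piMr.
move=> /andP[? ?]; split; first by apply/andP; split; lra.
rewrite -normr_slopew; have [s0|s0] := leP 0 (slopew y [::] w).
  rewrite ger0_norm// min_l ?lerDl//.
  have : 0 <= slopew y [::] w * q <= slopew y [::] w by rewrite mulr_ge0 ?ler_piMr.
  by move=> /andP[? ?]; apply/andP; split; lra.
rewrite ltr0_norm// min_r ?gerDl ?(ltW s0)//.
have : slopew y [::] w <= slopew y [::] w * q <= 0.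
  by rewrite ler_niMr ?mulr_le0_ge0 ?(ltW s0).
by move=> /andP[? ?]; apply/andP; split; lra.
Qed.

(** The rectangle of [w] takes [heightw w / delta] squares, rounded up.  The rounding
costs one square per word; this is paid for by the widths of the columns,
which are at least [lo * delta] and sum to 1. *)
Lemma coverable_limit_set N (delta lo : R) : (0 < N)%N -> 0 < lo -> 0 < delta ->
  (forall w, w \in cutset m b N delta -> lo * delta <= widthw b w <= delta) ->
  exists2 n, coverable (limit_set b y) delta n &
    n%:R * delta <= mass b y 0 N delta [::] + lo^-1.
Proof.
move=> N0 lo0 d0 H.
pose n w := (Num.truncn (heightw y [::] w / delta)).+1.
exists (\sum_(w <- cutset m b N delta) n w)%N.
  apply: (@sub_coverable _ _
    (\bigcup_(w in [set` cutset m b N delta]) rectangle b y w)).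
    move=> p /(_ N N0)[w /= wN pw].
    have [|v [v' [vC wE]]] := @cutset_prefix _ _ b N delta w; first by rewrite wN.
    by exists v => //; apply: (@rectangle_cat _ _ _ _ hb y01 v v'); rewrite -wE.
  apply: coverable_bigcup => w /H/andP[_ wd].
  apply: sub_coverable (rectangle_sub_strip wd) _.
  by apply: coverable_strip => //; exact: heightw_ge0.
rewrite natr_sum mulr_suml.
apply: le_trans (_ : \sum_(w <- cutset m b N delta)
  (heightw y [::] w + widthw b w / lo) <= _).
  rewrite big_seq [leRHS]big_seq; apply: ler_sum => w /H /andP[wl _].
  rewrite -natr1 mulrDl mul1r lerD//.
    by rewrite -ler_pdivlMr// truncn_le divr_ge0 ?heightw_ge0 ?(ltW d0).
  by rewrite ler_pdivlMr// mulrC.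
rewrite big_split /= -mulr_suml sum_cutset_widthw// mul1r lerD2r.
by apply: ler_sum => w _; rewrite powRr0 mulr1.
Qed.

End GraphUpper.

(** * First moments of the masses *)

Section Ext01.
Variables (R : realType) (n : nat).

Lemma ext01_last (v : rvec R n) : ext01 v n.+1 = 1.
Proof. by rewrite /ext01 /= nth_rcons size_tuple ltnn eqxx. Qed.

Lemma ext01_mid (v : rvec R n) (j : 'I_n) : ext01 v j.+1 = tnth v j.
Proof. by rewrite /ext01 /= nth_rcons size_tuple ltn_ord (tnth_nth 0). Qed.

Lemma ext01_default (v : rvec R n) k : (n.+1 < k)%N -> ext01 v k = 0.
Proof. by move=> nk; rewrite /ext01 nth_default//= size_rcons size_tuple. Qed.

Lemma ext01_itv (v : rvec R n) k :
  (forall j, 0 <= tnth v j <= 1) -> 0 <= ext01 v k <= 1.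
Proof.
move=> v01; case: (ltngtP k n.+1) => [|kn|->].
- case: k => [_|k kn]; first by rewrite /ext01 /= lexx ler01.
  by rewrite (ext01_mid v (Ordinal (kn : (k < n)%N))).
- by rewrite ext01_default// lexx ler01.
- by rewrite ext01_last lexx ler01.
Qed.

Lemma measurable_ext01 k : measurable_fun [set: rvec R n] (fun v => ext01 v k : R).
Proof.
case: (ltngtP k n.+1) => [|kn|->].
- case: k => [_|k kn]; first exact: measurable_cst.
  rewrite (_ : (fun v => _) = fun v : rvec R n => tnth v (Ordinal (kn : (k < n)%N))).
    exact: measurable_tnth.
  by apply/funext => v; rewrite -ext01_mid.
- rewrite (_ : (fun v => _) = fun=> 0); first exact: measurable_cst.
  by apply/funext => v; rewrite ext01_default.
- rewrite (_ : (fun v => _) = fun=> 1); first exact: measurable_cst.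
  by apply/funext => v; rewrite ext01_last.
Qed.

End Ext01.

Section Means.
Context (d : measure_display) (Th : measurableType d) (R : realType)
  (P : probability Th R) (m : nat) (b : nat -> R)
  (Y : seq 'I_m.+2 -> {RV P >-> rvec R m.+1}).
Hypotheses (hb : is_partition m.+2 b)
  (Y01 : forall u t j, 0 <= tnth (Y u t) j <= 1)
  (Yindep : mutually_independent Y) (Yid : identically_distributed Y).
Implicit Types (u v w : seq 'I_m.+2) (i : 'I_m.+2) (t : Th).

Lemma y_first t u : y_ Y t u 0 = 0. Proof. by []. Qed.

Lemma y_last t u : y_ Y t u m.+2 = 1. Proof. exact: ext01_last. Qed.

Lemma y_itv t u k : 0 <= y_ Y t u k <= 1. Proof. exact: ext01_itv. Qed.

Definition subtree u : set (seq 'I_m.+2) := [set u ++ v | v in setT].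

Lemma subtree_root u : subtree u u.
Proof. by exists [::]; rewrite ?cats0. Qed.

Lemma subtree_rcons u i : subtree (rcons u i) `<=` subtree u.
Proof. by move=> _ [v _ <-]; exists (i :: v); rewrite ?cat_rcons. Qed.

Lemma subtree_disjoint u i j : i != j ->
  subtree (rcons u i) `&` subtree (rcons u j) = set0.
Proof.
move=> ij; rewrite -subset0 => w [[v _ <-] [v' _]] /=.
by rewrite !cat_rcons => /eqP; rewrite eqseq_cat// eqxx /= eqseq_cons eq_sym (negPf ij).
Qed.

Lemma root_disjoint u i : [set u] `&` subtree (rcons u i) = set0.
Proof.
rewrite -subset0 => w [/= -> [v _]] /(congr1 size) /eqP.
by rewrite size_cat size_rcons addSn -addnS -[X in _ == X]addn0 eqn_add2l.
Qed.

Lemma root_subtree_disjoint u i j : i != j ->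
  ([set u] `|` subtree (rcons u i)) `&` subtree (rcons u j) = set0.
Proof. by move=> ij; rewrite setIUl root_disjoint subtree_disjoint// setU0. Qed.

Lemma observable_height u k : observable Y [set u] (fun t => height (y_ Y t) u k).
Proof.
have my j : measurable_fun [set: g_sigma_algebraType (cylinder Y [set u])]
    (fun t => y_ Y t u j : R).
  apply: (measurableT_comp (@measurable_ext01 R m.+1 j)) => _ B mB.
  by rewrite setTI; apply: sub_sigma_algebra; exact: cylinder1.
split; first by apply: measurableT_comp => //; exact: measurable_funB.
exists 1 => t; rewrite ger0_norm ?height_ge0//.
exact: (height_le1 (y_itv t)).
Qed.

Lemma observable_mass p n delta u :
  observable Y (subtree u) (fun t => mass b (y_ Y t) p n delta u).
Proof.
elim: n delta u => [|n IH] delta u.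
  by under eq_fun do rewrite mass_n0; exact: observable_cst.
have [d1|d1] := leP 1 delta.
  by under eq_fun do rewrite mass_ge1//; exact: observable_cst.
under eq_fun do rewrite massS//; apply: observable_sum => i.
apply: observableM; last exact: observable_mono (@subtree_rcons u i) (IH _ _).
apply: observableM; last exact: observable_cst.
apply: observable_mono (observable_height u i) => _ ->; exact: subtree_root.
Qed.

Definition mean_height (k : nat) : R := \int[P]_t height (y_ Y t) [::] k.

(** The integral depends on the law of [Y u] only. *)
Lemma mean_heightE u k : \int[P]_t height (y_ Y t) u k = mean_height k.
Proof.
pose h (v : rvec R m.+1) : R := `|ext01 v k.+1 - ext01 v k|.
have mh : measurable_fun setT h.
  by apply: measurableT_comp => //; apply: measurable_funB; exact: measurable_ext01.
have hE w : (\int[P]_t (height (y_ Y t) w k)%:E =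
    \int[distribution P (Y w)]_v (h v)%:E)%E.
  rewrite integral_distribution//; first exact/measurable_EFinP.
  exact: observable_integrable (observable_height w k).
rewrite /mean_height /Rintegral !hE; congr fine.
by apply: eq_measure_integral => A mA _; exact: Yid.
Qed.

Lemma mean_height_ge0 k : 0 <= mean_height k.
Proof. by apply: Rintegral_ge0 => t _; exact: height_ge0. Qed.

Lemma mean_height_le1 k : mean_height k <= 1.
Proof.
rewrite -[leRHS](@Rintegral_cst1 _ _ _ P); apply: le_Rintegral => //.
- exact: observable_integrable (observable_height _ _).
- exact: observable_integrable (observable_cst Y setT _).
- by move=> t _; exact: height_le1 (y_itv t) _ _.
Qed.

Lemma sum_mean_height_ge1 : 1 <= \sum_(i < m.+2) mean_height i.
Proof.
have oh (i : 'I_m.+2) : observable Y [set [::]]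
    (fun t => height (y_ Y t) [::] i) by exact: observable_height.
rewrite -(Rintegral_sum_observable _ oh).
rewrite -[leLHS](@Rintegral_cst1 _ _ _ P); apply: le_Rintegral => //.
- exact: observable_integrable (observable_cst Y setT _).
- exact: observable_integrable (observable_sum _ oh).
- by move=> t _; exact: sum_height_ge1 (y_first t) (y_last t) _.
Qed.

Variable p : R.
Hypotheses (p0 : 0 <= p)
  (mean_eq1 : \sum_(i < m.+2) mean_height i * width b i `^ p = 1).

(** In [massS], the height of a letter is independent of the mass in the subtree
that it leads to; the equation [mean_eq1] then carries the value 1 from the
stopped words back to the root. *)
Lemma mean_mass n delta u : \int[P]_t mass b (y_ Y t) p n delta u = 1.
Proof.
elim: n delta u => [|n IH] delta u.
  by under eq_Rintegral do rewrite mass_n0; rewrite Rintegral_cst1.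
have [d1|d1] := leP 1 delta.
  by under eq_Rintegral do rewrite mass_ge1//; rewrite Rintegral_cst1.
under eq_Rintegral do rewrite massS//.
rewrite (@Rintegral_sum_observable _ _ _ P _ _ _ Y (subtree u)); last first.
  move=> i; apply: observableM.
    apply: observableM; last exact: observable_cst.
    by apply: observable_mono (observable_height u i) => _ ->; exact: subtree_root.
  exact: observable_mono (@subtree_rcons u i) (observable_mass _ _ _ _).
rewrite -mean_eq1; apply: eq_bigr => i _.
rewrite (Rintegral_observableM Yindep (root_disjoint u i)); last 2 first.
- by apply: observableM; [exact: observable_height|exact: observable_cst].
- exact: observable_mass.
rewrite IH mulr1 RintegralZr ?mean_heightE//.
exact: observable_integrable (observable_height u i).
Qed.

End Means.

(** * Almost sure behaviour of the masses *)

Section Martingale.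
Context (d : measure_display) (Th : measurableType d) (R : realType)
  (P : probability Th R) (m : nat) (b : nat -> R)
  (Y : seq 'I_m.+2 -> {RV P >-> rvec R m.+1}).
Hypotheses (hb : is_partition m.+2 b)
  (Y01 : forall u t j, 0 <= tnth (Y u t) j <= 1)
  (Yindep : mutually_independent Y) (Yid : identically_distributed Y).
Implicit Types (u v w : seq 'I_m.+2) (i : 'I_m.+2) (t : Th).
Variable p : R.
Hypotheses (p0 : 0 <= p)
  (mean_eq1 : \sum_(i < m.+2) mean_height Y i * width b i `^ p = 1).

Variables (lo hi : R).
Hypotheses (lo0 : 0 < lo) (loi : forall i, lo <= width b i)
           (hi0 : 0 < hi) (hi1 : hi < 1) (hii : forall i, width b i <= hi).

(** The change of the mass when the scale [delta] is refined to [hi * delta]; one more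
level is allowed for reaching the finer scale. *)
Definition increment n delta u t : R :=
  mass b (y_ Y t) p n.+1 (hi * delta) u - mass b (y_ Y t) p n delta u.

Lemma observable_increment n delta u : observable Y (subtree u) (increment n delta u).
Proof. by apply: observableB; exact: observable_mass. Qed.

Lemma mean_increment n delta u : \int[P]_t increment n delta u t = 0.
Proof.
rewrite RintegralB//; last 2 first.
- exact: observable_integrable (observable_mass hb Y01 _ _ _ _).
- exact: observable_integrable (observable_mass hb Y01 _ _ _ _).
by rewrite !(mean_mass hb Y01 Yindep Yid mean_eq1) subrr.
Qed.

Lemma incrementS n delta u t : delta < 1 -> increment n.+1 delta u t =
  \sum_(i < m.+2) height (y_ Y t) u i * width b i `^ p *
    increment n (delta / width b i) (rcons u i) t.
Proof.
move=> d1; rewrite /increment [in LHS]massS//; last first.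
  have [d0|d0] := leP 0 delta; first by rewrite (le_lt_trans _ d1)// ler_piMl// ltW.
  by rewrite (lt_trans _ ltr01)// nmulr_llt0.
rewrite [X in _ - X]massS// -sumrB; apply: eq_bigr => i _.
by rewrite mulrBr mulrA.
Qed.

Lemma width_powR_le1 i : width b i `^ p <= 1.
Proof. by apply: powR_le1 => //; rewrite (width_ge0 hb) (width_le1 hb). Qed.

Lemma mass_le_letters n delta u t : hi <= delta ->
  mass b (y_ Y t) p n delta u <= m.+2%:R.
Proof.
move=> hd; have one : (1 : R) <= m.+2%:R by rewrite (ler_nat _ 1).
case: n => [|n]; first by rewrite mass_n0.
have [d1|d1] := leP 1 delta; first by rewrite mass_ge1.
rewrite massS// -[leRHS]mulr1 -[in leRHS](card_ord m.+2) mulr_natl -sumr_const.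
apply: ler_sum => i _; rewrite mass_ge1; last first.
  by rewrite ler_pdivlMr ?(width_gt0 hb)// mul1r (le_trans (hii i)).
rewrite mulr1 mulr_ile1 ?height_ge0 ?powR_ge0 ?width_powR_le1//.
exact: height_le1 (y_itv Y01 t) _ _.
Qed.

(** At such a scale nothing has been split yet, and after refinement words have at
most one letter. *)
Lemma variance_increment_ge1 n delta u : 1 <= delta ->
  \int[P]_t (increment n delta u t) ^+ 2 <= m.+2%:R ^+ 2 * delta `^ p.
Proof.
move=> d1; apply: (@le_trans _ _ (m.+2%:R ^+ 2)); last first.
  rewrite ler_peMr ?sqr_ge0// (_ : 1 = 1 `^ p); last by rewrite powR1.
  by rewrite ge0_ler_powR// ?nnegrE// (le_trans _ d1).
rewrite -[leRHS](@Rintegral_cst1 _ _ _ P); apply: le_Rintegral => //.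
- under eq_fun do rewrite expr2.
  exact: observable_integrable
    (observableM (observable_increment _ _ _) (observable_increment _ _ _)).
- exact: observable_integrable (observable_cst Y setT _).
- move=> t _; rewrite -real_normK ?num_real// ler_sqr ?nnegrE ?normr_ge0//.
  rewrite /increment [X in _ - X]mass_ge1//.
  have h1 : mass b (y_ Y t) p n.+1 (hi * delta) u <= m.+2%:R.
    by apply: mass_le_letters; rewrite ler_peMr// ltW.
  have h2 := mass_ge0 b (y_ Y t) p n.+1 (hi * delta) u.
  have h3 : (1 : R) <= m.+2%:R by rewrite (ler_nat _ 1).
  by rewrite ler_norml; apply/andP; split; lra.
Qed.

(** The terms of [incrementS] for different letters are orthogonal, since increments
are centred and those of different subtrees are independent.  In the diagonal
terms, the square of a height is at most the height, and the bound at the scale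
[delta / width b i] cancels one of the two factors [width b i `^ p]; what is left
sums to 1 by [mean_eq1], so that the bound reproduces itself. *)
Lemma variance_increment n delta u : hi ^+ n <= delta ->
  \int[P]_t (increment n delta u t) ^+ 2 <= m.+2%:R ^+ 2 * delta `^ p.
Proof.
elim: n delta u => [|n IH] delta u hd; first exact: variance_increment_ge1.
have [d1|d1] := leP 1 delta; first exact: variance_increment_ge1.
have oF i : observable Y (subtree u) (fun t => height (y_ Y t) u i * width b i `^ p *
    increment n (delta / width b i) (rcons u i) t).
    apply: observableM; last first.
      exact: observable_mono (@subtree_rcons _ u i) (observable_increment _ _ _).
    apply: observableM; last exact: observable_cst.
    by apply: observable_mono (observable_height Y01 u i) => _ ->; exact: subtree_root.
  under eq_Rintegral => t _ do rewrite incrementS//.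
  rewrite (Rintegral_sqr_sum oF); last first.
    move=> i j ij.
    under eq_Rintegral do rewrite /= mulrA.
    rewrite (Rintegral_observableM Yindep (root_subtree_disjoint u ij)).
    + by rewrite mean_increment mulr0.
    + apply: observableM; last first.
        apply: observableM; last exact: observable_cst.
        by apply: observable_mono (observable_height Y01 u j) => _ ->; left.
      apply: observableM.
        apply: observableM; last exact: observable_cst.
        by apply: observable_mono (observable_height Y01 u i) => _ ->; left.
      by apply: observable_mono (observable_increment _ _ _) => w; right.
    + exact: observable_increment.
  have d0 : 0 < delta by rewrite (lt_le_trans _ hd)// exprn_gt0.
  rewrite -[leRHS]mulr1 -[X in _ <= _ * X]mean_eq1 mulr_sumr; apply: ler_sum => i _.
  have li0 := width_gt0 hb i.
  under eq_Rintegral => t _ do rewrite exprMn.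
  rewrite (Rintegral_observableM Yindep (root_disjoint u i)); last 2 first.
  + under eq_fun do rewrite expr2.
    by apply: observableM; apply: observableM;
        (exact: observable_height || exact: observable_cst).
  + by under eq_fun do rewrite expr2; apply: observableM; exact: observable_increment.
  have h1 : \int[P]_t (height (y_ Y t) u i * width b i `^ p) ^+ 2 <=
      mean_height Y i * (width b i `^ p) ^+ 2.
    rewrite -(mean_heightE Y01 Yid u) -RintegralZr//; last first.
      exact: observable_integrable (observable_height Y01 u i).
    apply: le_Rintegral => //.
    * under eq_fun do rewrite expr2.
      apply: (@observable_integrable _ _ _ P _ _ _ Y [set u]).
      by apply: observableM; apply: observableM;
        (exact: observable_height || exact: observable_cst).
    * apply: (@observable_integrable _ _ _ P _ _ _ Y [set u]).
      by apply: observableM;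
        (exact: observable_height || exact: observable_cst).
    * move=> t _; rewrite exprMn ler_wpM2r ?sqr_ge0// expr2 ler_piMl ?height_ge0//.
      exact: height_le1 (y_itv Y01 t) _ _.
  have h2 : \int[P]_t (increment n (delta / width b i) (rcons u i) t) ^+ 2 <=
      m.+2%:R ^+ 2 * (delta / width b i) `^ p.
    apply: IH; rewrite ler_pdivlMr//; apply: le_trans hd.
    by rewrite exprSr ler_wpM2l// exprn_ge0// ltW.
  apply: le_trans (ler_pM _ _ h1 h2) _; rewrite ?Rintegral_ge0//.
    by move=> t _; exact: sqr_ge0.
    by move=> t _; exact: sqr_ge0.
  have -> : delta `^ p = (delta / width b i) `^ p * width b i `^ p.
    by rewrite -powRM ?divr_ge0 ?divfK ?gt_eqF// ltW.
  by rewrite le_eqVlt; apply/orP; left; apply/eqP; ring.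
Qed.
Definition level_mass (k : nat) u t : R := mass b (y_ Y t) p k (hi ^+ k) u.

Lemma level_massS k u t :
  level_mass k.+1 u t = level_mass k u t + increment k (hi ^+ k) u t.
Proof. by rewrite /level_mass /increment exprS addrC subrK. Qed.

Lemma level_massB k n u t : level_mass (k + n) u t =
  level_mass k u t + \sum_(j < n) increment (k + j) (hi ^+ (k + j)) u t.
Proof.
elim: n => [|n IH]; first by rewrite addn0 big_ord0 addr0.
rewrite addnS level_massS IH big_ord_recr /=. by rewrite -addrA.
Qed.

(** The square root of [hi `^ p]: along the scales [hi ^+ k], standard deviations of
increments decrease like [decay ^+ k]. *)
Definition decay : R := hi `^ (p / 2).

Lemma decay_gt0 : 0 < decay. Proof. exact: powR_gt0. Qed.

Lemma decay_sqr k : (hi ^+ k) `^ p = (decay ^+ k) ^+ 2.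
Proof.
rewrite /decay -exprM -!powR_mulrn ?powR_ge0 ?(ltW hi0)// -!powRrM.
by congr powR; rewrite natrM; field.
Qed.

(** The inequality [2 * l * `|D| <= D ^+ 2 + l ^+ 2], with [l] the bound on the standard
deviation of [D], plays the role of the Cauchy-Schwarz inequality. *)
Lemma mean_abs_increment k u :
  \int[P]_t `|increment k (hi ^+ k) u t| <= m.+2%:R * decay ^+ k.
Proof.
set D := increment k (hi ^+ k) u; set l := m.+2%:R * decay ^+ k.
have l0 : 0 < l by rewrite mulr_gt0 ?ltr0n// exprn_gt0// decay_gt0.
have oD : observable Y (subtree u) D := observable_increment k (hi ^+ k) u.
have oD2 : observable Y (subtree u) (fun t => (D t) ^+ 2).
  by under eq_fun do rewrite expr2; exact: observableM.
have oDc := observableM oD2 (observable_cst Y (subtree u) (2 * l)^-1).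
apply: (@le_trans _ _ (\int[P]_t (D t ^+ 2 * (2 * l)^-1 + l / 2))).
  apply: le_Rintegral => //.
  - exact: observable_integrable (observable_norm oD).
  - exact: observable_integrable (observableD oDc (observable_cst Y _ _)).
  move=> t _; rewrite -subr_ge0 (_ : _ - _ = (`|D t| - l) ^+ 2 / (2 * l)).
    by rewrite divr_ge0 ?sqr_ge0// mulr_ge0// ltW.
  by rewrite -(real_normK (num_real (D t))); field; rewrite gt_eqF.
rewrite RintegralD//; last 2 first.
- exact: observable_integrable oDc.
- exact: observable_integrable (observable_cst Y setT _).
rewrite Rintegral_cst1 RintegralZr//; last exact: observable_integrable oD2.
have := variance_increment u (lexx (hi ^+ k)).
rewrite -/D decay_sqr -exprMn -/l => h.
apply: (@le_trans _ _ (l ^+ 2 / (2 * l) + l / 2)).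
  by rewrite lerD2r ler_wpM2r// invr_ge0 mulr_ge0// ltW.
by rewrite le_eqVlt; apply/orP; left; apply/eqP; field; rewrite gt_eqF.
Qed.

Definition variation (k : nat) u t : \bar R :=
  (\sum_(0 <= j <oo) `|increment (k + j) (hi ^+ (k + j)) u t|%:E)%E.

Lemma measurable_abs_increment n delta u :
  measurable_fun [set: Th] (fun t => `|increment n delta u t|%:E).
Proof.
apply/measurable_EFinP.
exact: observable_measurable (observable_norm (observable_increment n delta u)).
Qed.

Lemma measurable_variation k u : measurable_fun [set: Th] (variation k u).
Proof.
apply: ge0_emeasurable_sum => [j t _ _|j _]; first by rewrite lee_fin.
exact: measurable_abs_increment.
Qed.

Lemma variation_ge0 k u t : (0 <= variation k u t)%E.
Proof. by apply: nneseries_ge0 => j _ _; rewrite lee_fin. Qed.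

Lemma mean_variation k u : decay < 1 ->
  (\int[P]_t variation k u t <= (m.+2%:R * decay ^+ k / (1 - decay))%:E)%E.
Proof.
move=> decay1.
rewrite integral_nneseries//; last first.
  by move=> j; exact: measurable_abs_increment.
have intE j : (\int[P]_t `|increment (k + j) (hi ^+ (k + j)) u t|%:E =
    (\int[P]_t `|increment (k + j) (hi ^+ (k + j)) u t|)%:E)%E.
  rewrite /Rintegral fineK//; apply: integrable_fin_num => //.
  exact: observable_integrable (observable_norm (observable_increment _ _ _)).
apply: lime_le.
  by apply: is_cvg_nneseries => j _ _; apply: integral_ge0 => t _; rewrite lee_fin.
apply: nearW => n; rewrite big_mkord.
under eq_bigr => j _ do rewrite intE.
rewrite sumEFin lee_fin; apply: le_trans (geometric_partial_sum_le n _ _).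
- apply: ler_sum => j _; apply: le_trans (mean_abs_increment _ _) _.
  by rewrite exprD mulrA.
- by rewrite mulr_ge0// exprn_ge0// ltW// decay_gt0.
- by rewrite decay1 ltW// decay_gt0.
Qed.

Lemma abs_sum_increment_le k n u t :
  (`|\sum_(j < n) increment (k + j) (hi ^+ (k + j)) u t|%:E <= variation k u t)%E.
Proof.
apply: (@le_trans _ _ (\sum_(j < n) `|increment (k + j) (hi ^+ (k + j)) u t|)%:E).
  by rewrite lee_fin ler_norm_sum.
rewrite -sumEFin -(big_mkord xpredT
  (fun j => (`|increment (k + j) (hi ^+ (k + j)) u t|)%:E)).
by apply: nneseries_lim_ge => j _ _; rewrite lee_fin.
Qed.

(** The total variation has finite mean, hence is almost surely finite. *)
Lemma level_mass_bounded u : decay < 1 ->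
  {ae P, forall t, exists c, forall k, level_mass k u t <= c}.
Proof.
move=> decay1.
have iV : P.-integrable setT (variation 0 u).
  apply/integrableP; split; first exact: measurable_variation.
  under eq_integral => t _ do rewrite (gee0_abs (variation_ge0 0 u t)).
  exact: le_lt_trans (mean_variation 0 u decay1) (ltry _).
have := integrable_ae measurableT iV; apply: filterS => t /(_ I) fV.
exists (1 + fine (variation 0 u t)) => k.
have := level_massB 0 k u t; rewrite add0n => ->.
rewrite {1}/level_mass mass_n0 lerD2l.
rewrite -lee_fin fineK//; apply: le_trans (abs_sum_increment_le 0 k u t).
by rewrite lee_fin ler_norm.
Qed.

(** The event that the level masses at [u] have lower limit 0, expressed by
countable operations. *)
Definition vanishing u : set Th :=
  \bigcap_j \bigcup_(k in [set k | (j <= k)%N])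
    (level_mass k u @^-1` `]-oo, j.+1%:R^-1[).

Lemma vanishingP u t : vanishing u t <->
  forall e j, 0 < e -> exists2 k, (j <= k)%N & level_mass k u t < e.
Proof.
split=> [B e j e0|B j _].
  have [n] := ltr_add_invr e0; rewrite add0r => ne.
  have [k /= jk] := B (maxn j n) I; rewrite in_itv/= => kl.
  exists k; first exact: leq_trans (leq_maxl _ _) jk.
  apply: lt_trans kl _; apply: le_lt_trans ne.
  by rewrite lef_pV2 ?posrE// ler_nat ltnS leq_maxr.
have [|k jk kl] := B j.+1%:R^-1 j; first by rewrite invr_gt0.
by exists k => //=; rewrite in_itv.
Qed.

Lemma not_vanishing u t : ~ vanishing u t ->
  exists2 c, 0 < c & exists j, forall k, (j <= k)%N -> c <= level_mass k u t.
Proof.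
move/existsNP => [j /existsNP[_ nB]]; exists j.+1%:R^-1; first by rewrite invr_gt0.
exists j => k jk; rewrite leNgt; apply/negP => kl; apply: nB.
by exists k => //=; rewrite in_itv.
Qed.

Lemma vanishing_history u : history Y (subtree u) (vanishing u).
Proof.
rewrite /history; change (measurable
  (vanishing u : set (g_sigma_algebraType (cylinder Y (subtree u))))).
apply: bigcapT_measurable => j; apply: bigcup_measurable => k _.
have [mk _] := observable_mass hb Y01 p k (hi ^+ k) u.
by rewrite -[X in measurable X]setTI; exact: mk.
Qed.

(** A level mass followed by others that are arbitrarily small is lost entirely
through increments. *)
Lemma level_mass_le_variation u k t : vanishing u t ->
  ((level_mass k u t)%:E <= variation k u t)%E.
Proof.
move=> /vanishingP B; apply/lee_addgt0Pr => e e0.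
have [n kn ne] := B e k e0.
have := level_massB k (n - k) u t; rewrite subnKC// => nE.
apply: le_trans (_ : ((- \sum_(j < n - k)
  increment (k + j) (hi ^+ (k + j)) u t)%:E + e%:E <= _)%E).
  by rewrite -EFinD lee_fin; lra.
rewrite leeD2r//; apply: le_trans (abs_sum_increment_le k (n - k) u t).
by rewrite lee_fin -normrN ler_norm.
Qed.
Lemma measurable_vanishing u : measurable (vanishing u).
Proof. exact: history_measurable (@vanishing_history u). Qed.

(** Take [k] such that the variation from level [k] on has mean at most 1/2.  On the
vanishing event the level mass is at most the variation, so at least half of
its mean 1 comes from the complement; and there it is at most the number of
stopped words.  This bounds the probability of the complement from below, by a
constant that does not involve [u]. *)
Lemma vanishing_prob_lt1 : decay < 1 ->
  exists2 c : R, 0 <= c < 1 & forall u, (P (vanishing u) <= c%:E)%E.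
Proof.
move=> decay1.
(* This threshold turns the bound of mean_variation into 1/2. *)
pose e : R := (1 - decay) / 2 / m.+2%:R.
have e0 : 0 < e by rewrite !divr_gt0 ?subr_gt0 ?ltr0n.
have [k ke] : exists k, decay ^+ k <= e.
  by apply: exists_small_power => //; rewrite decay1 ltW// decay_gt0.
(* The successor keeps S positive. *)
pose S : R := (size (cutset m.+2 b k (hi ^+ k))).+1%:R.
have S1 : 1 <= S by rewrite (ler_nat _ 1).
have S0 : 0 < S by rewrite (lt_le_trans ltr01).
exists (1 - (2 * S)^-1).
  rewrite subr_ge0 ltrBlDr ltrDl invr_gt0 mulr_gt0// andbT invf_le1 ?mulr_gt0//.
  by lra.
move=> u; have mB := measurable_vanishing u.
have mBc : measurable (~` vanishing u) by exact: measurableC.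
have H : (1 <= (2^-1)%:E + S%:E * P (~` vanishing u))%E.
  have ioM := observable_integrable (observable_mass hb Y01 p k (hi ^+ k) u).
  have <- : (\int[P]_t (level_mass k u t)%:E = 1)%E.
    rewrite -(fineK (integrable_fin_num measurableT ioM)); congr EFin.
    exact (mean_mass hb Y01 Yindep Yid mean_eq1 k (hi ^+ k) u).
  have -> : (S%:E * P (~` vanishing u) = \int[P]_t (S * \1_(~` vanishing u) t)%:E)%E.
    under eq_integral do rewrite EFinM.
    rewrite ge0_integralZl_EFin//; last exact/measurable_EFinP.
    by rewrite integral_indic// setIT.
  apply: (@le_trans _ _
    (\int[P]_t (variation k u t + (S * \1_(~` vanishing u) t)%:E))%E).
    apply: ge0_le_integral => //.
    - by move=> t _; rewrite lee_fin mass_ge0.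
    - apply/measurable_EFinP.
      exact (observable_measurable (observable_mass hb Y01 p k (hi ^+ k) u)).
    - apply: emeasurable_funD; first exact: measurable_variation.
      by apply/measurable_EFinP; apply: measurable_funM.
    move=> t _; have [Bt|nBt] := pselect (vanishing u t).
      rewrite indicE memNset; last by move=> /(_ Bt).
      by rewrite mulr0 adde0; exact: level_mass_le_variation.
    rewrite indicE mem_set// mulr1; apply: le_trans (_ : S%:E <= _)%E; last first.
      by rewrite leeDr// variation_ge0.
    rewrite lee_fin; apply: le_trans (mass_le_size hb (y_itv Y01 t) k _ u p0) _.
    by rewrite ler_nat.
  rewrite ge0_integralD//; first last.
  - by apply/measurable_EFinP; apply: measurable_funM.
  - by move=> t _; rewrite lee_fin mulr_ge0// ltW.
  - exact: measurable_variation.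
  - by move=> t _; exact: variation_ge0.
  rewrite leeD2r//; apply: le_trans (mean_variation k u decay1) _.
  rewrite lee_fin ler_pdivrMr ?subr_gt0// mulrC -ler_pdivlMr ?ltr0n//.
  by apply: le_trans ke _; rewrite /e [2^-1 * _]mulrC.
move: H; rewrite probability_setC//.
have finB : P (vanishing u) \is a fin_num by exact: fin_num_measure.
rewrite -(fineK finB) -EFinB -EFinM -EFinD !lee_fin => H.
rewrite lerBrDl -lerBrDr.
have : 2^-1 <= S * (1 - fine (P (vanishing u))) by lra.
by rewrite mulrC -ler_pdivrMr// -invfM.
Qed.

(** Entering a subtree through the letter [i] divides scales by [width b i], which
[J] further levels make up for.  The comparison is made for the exponent 0,
where refinement is monotone, and transferred to the exponent [p]. *)
Lemma level_mass_child : exists2 C, 0 < C & exists J, forall k u i t,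
  C * height (y_ Y t) u i * level_mass k (rcons u i) t <= level_mass (k + J) u t.
Proof.
have lo1 : lo <= 1 by rewrite (le_trans (loi ord0))// (width_le1 hb).
have [J0 J0lo] : exists k, hi ^+ k <= lo.
  by apply: exists_small_power => //; rewrite hi1 ltW.
(* J must be positive for massS to apply at level k + J. *)
pose J := J0.+1; have hJ : hi ^+ J <= lo.
  by apply: le_trans J0lo; rewrite ler_wiXn2l// ltW.
have hX n : 0 < hi ^+ n by rewrite exprn_gt0.
exists ((lo * hi ^+ J) `^ p); first by rewrite powR_gt0// mulr_gt0.
exists J => k u i t; have li0 := width_gt0 hb i.
have h1 := @mass_le_mass0 _ _ _ hb _ hi0 hii (y_ Y t) p k (hi ^+ k)
  (rcons u i) p0 (lexx _).
have h2 : height (y_ Y t) u i * mass b (y_ Y t) 0 k (hi ^+ k) (rcons u i) <=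
    mass b (y_ Y t) 0 (k + J) (hi ^+ (k + J)) u.
  rewrite {2}/J addnS massS//; last by rewrite -addnS -/J exprn_ilt1// ?ltW ?addnS.
  rewrite (bigD1 i)//= powRr0 mulr1 -[leLHS]addr0 lerD//; last first.
    by apply: sumr_ge0 => j _; rewrite !mulr_ge0 ?height_ge0 ?powR_ge0 ?mass_ge0.
  rewrite ler_wpM2l ?height_ge0//.
  apply: (mass0_refine hb (y_first Y t) (y_last Y t)); first by rewrite leq_addr.
  rewrite ler_pdivrMr// -addnS -/J exprD ler_wpM2l ?(ltW (hX k))//.
  exact: le_trans hJ (loi i).
have h3 : (lo * hi ^+ (k + J)) `^ p * mass b (y_ Y t) 0 (k + J) (hi ^+ (k + J)) u <=
    level_mass (k + J) u t.
  by apply: (mass0_le_mass hb lo0 loi) => //; rewrite hX exprn_ile1// ltW.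
apply: le_trans h3; rewrite exprD.
have -> : (lo * (hi ^+ k * hi ^+ J)) `^ p = (lo * hi ^+ J) `^ p * (hi ^+ k) `^ p.
  by rewrite -powRM ?mulr_ge0 ?(ltW lo0) ?(ltW (hX _))//; congr powR; ring.
rewrite -!mulrA ler_wpM2l ?powR_ge0//.
apply: (@le_trans _ _ (height (y_ Y t) u i *
   ((hi ^+ k) `^ p * mass b (y_ Y t) 0 k (hi ^+ k) (rcons u i)))).
  by rewrite ler_wpM2l ?height_ge0.
by rewrite mulrCA ler_wpM2l ?powR_ge0// -exprD.
Qed.

Lemma vanishing_child u i t : 
  0 < height (y_ Y t) u i -> vanishing u t -> vanishing (rcons u i) t.
Proof.
have [C C0 [J H]] := level_mass_child.
move=> a0 /vanishingP B; apply/vanishingP => e j e0.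
have Ca0 : 0 < C * height (y_ Y t) u i by rewrite mulr_gt0.
have [k jk ke] := B (C * height (y_ Y t) u i * e) (j + J)%N (mulr_gt0 Ca0 e0).
have Jk : (J <= k)%N by rewrite (leq_trans (leq_addl j J)).
exists (k - J)%N; first by rewrite leq_subRL// addnC.
rewrite -(ltr_pM2l Ca0); apply: le_lt_trans ke.
by rewrite -[in leRHS](subnK Jk); exact: H.
Qed.

Hypothesis hy01 : forall i : nat, (1 <= i <= m.+1)%N ->
  P [set t | y_ Y t [::] i = 0 \/ y_ Y t [::] i = 1] = 0%E.

Lemma boundary_null u (k : nat) : (1 <= k <= m.+1)%N ->
  measurable [set t | y_ Y t u k = 0 \/ y_ Y t u k = 1] /\
  P [set t | y_ Y t u k = 0 \/ y_ Y t u k = 1] = 0%E.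
Proof.
move=> km.
pose A : set (rvec R m.+1) :=
  (fun z : rvec R m.+1 => ext01 z k : R) @^-1` ([set 0] `|` [set 1]).
have mA : measurable A.
  rewrite /A -[X in measurable X]setTI; apply: measurable_ext01 => //.
  by apply: measurableU; exact: measurable_set1.
have E w : [set t | y_ Y t w k = 0 \/ y_ Y t w k = 1] = Y w @^-1` A by [].
rewrite E; split; first exact: measurable_funPTI.
have := Yid u [::] mA; rewrite /distribution /pushforward => ->.
by rewrite -E hy01.
Qed.

(** The first and the last heights at [u] vanish only if an interior value is 0 or
1, a null event.  Outside it, [vanishing_child] leads from [u] to both extreme
subtrees, which are independent. *)
Lemma vanishing_prob_step u :
  (P (vanishing u) <=
   P (vanishing (rcons u ord0)) * P (vanishing (rcons u ord_max)))%E.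
Proof.
have [mN0 N0] := @boundary_null u 1 isT.
have [mN1 N1] : _ /\ _ := @boundary_null u m.+1 (leqnn _).
rewrite -(history_indep Yindep _ (@vanishing_history _)
  (@vanishing_history _)); last first.
  exact: subtree_disjoint.
have mI := measurableI _ _ (measurable_vanishing (rcons u ord0))
  (measurable_vanishing (rcons u ord_max)).
have mU := measurableU _ _ mN0 mN1.
apply: (@le_trans _ _ (P ((vanishing (rcons u ord0) `&` vanishing (rcons u ord_max)) `|`
   ([set t | y_ Y t u 1 = 0 \/ y_ Y t u 1 = 1] `|`
    [set t | y_ Y t u m.+1 = 0 \/ y_ Y t u m.+1 = 1])))).
  apply: le_measure; rewrite ?inE//; [exact: measurable_vanishing|exact: measurableU|].
  move=> t Bt.
  have [N|/not_orP[n0 n1]] := pselect ([set t | y_ Y t u 1 = 0 \/ y_ Y t u 1 = 1] t).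
    by right; left.
  have [N|/not_orP[n2 n3]] :=
    pselect ([set t | y_ Y t u m.+1 = 0 \/ y_ Y t u m.+1 = 1] t).
    by right; right.
  left; split; apply: vanishing_child => //; rewrite /height lt_neqAle normr_ge0 andbT
    eq_sym normr_eq0 subr_eq0; apply/eqP.
    by rewrite y_first.
  by rewrite /= y_last => /esym.
apply: le_trans (measureU2 _ mI mU) _.
rewrite -[leRHS]adde0; apply: leeD => //.
apply: le_trans (measureU2 _ mN0 mN1) _.
rewrite -[leRHS]adde0; apply: leeD.
  by have := lexx (0 : \bar R)%E; rewrite -{1}N0.
by have := lexx (0 : \bar R)%E; rewrite -{1}N1.
Qed.

(** Starting from the uniform bound [c], each use of [vanishing_prob_step] gains a
factor [c]. *)
Lemma vanishing_null u : decay < 1 -> P (vanishing u) = 0%E.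
Proof.
move=> /vanishing_prob_lt1 [c /andP[c0 c1] Pc].
have Pcn n v : (P (vanishing v) <= (c ^+ n)%:E)%E.
  elim: n v => [|n IH] v; first exact: probability_le1 (measurable_vanishing v).
  apply: le_trans (vanishing_prob_step v) _.
  by rewrite exprS EFinM; apply: lee_pmul.
apply/eqP; rewrite -measure_le0; apply/lee_addgt0Pr => e e0; rewrite add0e.
have [n ne] : exists n, c ^+ n <= e by apply: exists_small_power => //; rewrite c0.
by apply: le_trans (Pcn n u) _; rewrite lee_fin.
Qed.

Lemma decay_lt1 : 0 < p -> decay < 1.
Proof.
move=> pp; have : hi `^ (p / 2) < 1 `^ (p / 2).
  by apply: gt0_ltr_powR; rewrite ?nnegrE ?divr_gt0// ltW.
by rewrite powR1.
Qed.

(** The level masses of exponent 0 are at least 1 and have mean 1. *)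
Lemma level_mass_eq1 u : p = 0 -> {ae P, forall t, forall k, level_mass k u t = 1}.
Proof.
move=> pE; apply: ae_foralln => k.
have oM := observableB (observable_mass hb Y01 p k (hi ^+ k) u) (observable_cst Y _ 1).
have mM := (measurable_EFinP _ _).2 (observable_measurable oM).
have ge1 t : 1 <= level_mass k u t.
  by rewrite /level_mass pE (mass0_ge1 hb (y_first Y t) (y_last Y t)).
have I0 : \int[P]_t (level_mass k u t - 1) = 0.
  rewrite RintegralB//; last 2 first.
  - exact: observable_integrable (observable_mass hb Y01 _ _ _ _).
  - exact: observable_integrable (observable_cst Y setT _).
  by rewrite (mean_mass hb Y01 Yindep Yid mean_eq1) Rintegral_cst1 subrr.
have A0 : (\int[P]_t `|(level_mass k u t - 1)%:E| = 0)%E.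
  under eq_integral => t _ do rewrite gee0_abs ?lee_fin ?subr_ge0 ?ge1//.
  rewrite -[LHS]fineK; last first.
    exact (integrable_fin_num measurableT (observable_integrable oM)).
  by congr EFin; exact: I0.
have /(_ A0) := (@ae_eq_integral_abs _ _ _ P _ measurableT _ mM).1.
apply: filterS => t /(_ I) /= [] /eqP.
by rewrite subr_eq0 => /eqP.
Qed.

(** The case [p = 0] has to be separated, because the increments are summable only
when [decay < 1]. *)
Lemma level_mass_pinched u : {ae P, forall t, exists c1 c2 j,
  0 < c1 /\ forall k, (j <= k)%N -> c1 <= level_mass k u t <= c2}.
Proof.
have [pE|pN] := eqVneq p 0.
  have := level_mass_eq1 u pE; apply: filterS => t H.
  by exists 1, 1, 0%N; split => // k _; rewrite H lexx.
have decay1 : decay < 1 by apply: decay_lt1; rewrite lt_neqAle eq_sym pN.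
have : {ae P, forall t, ~ vanishing u t}.
  exists (vanishing u); split => //; [|exact: vanishing_null|].
    exact: measurable_vanishing.
  by move=> t /contrapT.
apply: filterS2 (level_mass_bounded u decay1) => t [c2 H2].
move=> /not_vanishing[c1 c10 [j H1]].
by exists c1, c2, j; split => // k jk; rewrite H1 ?H2.
Qed.

End Martingale.

(** * The exponent and the dimension of the graph *)

Section Exponent.
Variables (R : realType) (n : nat) (a l : 'I_n -> R).
Hypotheses (a0 : forall i, 0 <= a i) (a1 : forall i, a i <= 1)
  (suma : 1 <= \sum_i a i) (l0 : forall i, 0 < l i) (l1 : forall i, l i < 1)
  (suml : \sum_i l i = 1).

Lemma powR_decreasing (x r q : R) : 0 < x < 1 -> r < q -> x `^ q < x `^ r.
Proof.
move=> /andP[x0 x1] rq; rewrite /powR gt_eqF// ltr_expR.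
by rewrite ltr_nM2r// ln_lt0// x0.
Qed.

Lemma continuous_powR_exponent (x : R) :
  0 < x -> continuous (fun r : R => x `^ (r - 1)).
Proof.
move=> x0 r; rewrite /powR gt_eqF//.
apply: (@continuous_comp _ _ _ (fun r : R => (r - 1) * ln x) expR).
  by apply: cvgM; [apply: cvgB; [exact: cvg_id|exact: cvg_cst]|exact: cvg_cst].
exact: continuous_expR.
Qed.

(** Strictness comes from a positive coefficient, which exists since their sum is
at least 1. *)
Lemma exponent_sum_decreasing (r q : R) : r < q ->
  \sum_i a i * l i `^ (q - 1) < \sum_i a i * l i `^ (r - 1).
Proof.
move=> rq; have lrq i : l i `^ (q - 1) < l i `^ (r - 1).
  by apply: powR_decreasing; rewrite ?l0 ?l1// ltrD2r.
have [i ai] : exists i, 0 < a i.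
  apply/not_existsP => H; have := lt_le_trans ltr01 suma.
  rewrite big1 ?ltxx// => i _; apply/eqP; rewrite eq_le a0 andbT leNgt.
  exact/negP/H.
rewrite (bigD1 i)//= [ltRHS](bigD1 i)//=; apply: ltr_leD.
  by rewrite ltr_pM2l.
by apply: ler_sum => j _; rewrite ler_wpM2l// ltW.
Qed.

(** The continuous function in question is at least 1 for [r = 1], where it is the
sum of the [a i], and at most 1 for [r = 2], where it is at most the sum of the
[l i]. *)
Lemma exists_exponent : exists2 s : R, 1 <= s &
  \sum_i a i * l i `^ (s - 1) = 1 /\
  forall r, \sum_i a i * l i `^ (r - 1) = 1 -> s = r.
Proof.
pose g (r : R) := \sum_i a i * l i `^ (r - 1).
have cg : continuous g.
  move=> r; apply: cvg_big => [|i _]; first exact: add_continuous.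
  by apply: cvgM; [exact: cvg_cst|exact: continuous_powR_exponent].
have g1 : 1 <= g 1.
  by rewrite /g; under eq_bigr do rewrite subrr powRr0 mulr1.
have g2 : g 2 <= 1.
  rewrite /g -[leRHS]suml; apply: ler_sum => i _.
  rewrite (_ : 2 - 1 = 1); last by ring.
  by rewrite powRr1 ?ler_piMl// ltW.
have le12 : (1 : R) <= 2 by lra.
have [||s] := IVT (f := g) (v := 1) le12.
- exact: continuous_subspaceT.
- by rewrite ge_min g2 orbT le_max g1.
rewrite in_itv/= => /andP[s1 _] gs; exists s => //; split => // r gr.
apply/eqP; case: (ltgtP s r) => // h; exfalso.
  by have := exponent_sum_decreasing h; rewrite -/(g s) gs gr ltxx.
by have := exponent_sum_decreasing h; rewrite -/(g s) gs gr ltxx.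
Qed.

End Exponent.

(** Each column leaves room for another one, of width at least [lo], hence has width
at most [1 - lo]. *)
Lemma width_bounds (R : realType) (m : nat) (b : nat -> R) : is_partition m.+2 b ->
  exists lo hi : R, [/\ 0 < lo, forall i : 'I_m.+2, lo <= width b i, 0 < hi,
    hi < 1 & forall i : 'I_m.+2, width b i <= hi].
Proof.
move=> hb; have l0 := width_gt0 hb.
pose lo := \big[Num.min/1]_(i < m.+2) width b i.
have lo0 : 0 < lo by apply: lt_bigmin => // i _; exact: l0.
have loi (i : 'I_m.+2) : lo <= width b i by exact: bigmin_le_cond.
have hii (i : 'I_m.+2) : width b i <= 1 - lo.
  have [j ji] : exists j : 'I_m.+2, j != i.
    by case: (eqVneq i ord0) => [->|]; [exists ord_max|exists ord0; rewrite eq_sym].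
  have := sum_width hb; rewrite (bigD1 i)//= (bigD1 j)//= => <-.
  have S0 : 0 <= \sum_(k < m.+2 | (k != i) && (k != j)) width b k.
    by apply: sumr_ge0 => k _; exact: ltW.
  by have := loi j; lra.
exists lo, (1 - lo); split => //; first exact: lt_le_trans (l0 ord0) (hii ord0).
by rewrite ltrBlDr ltrDl.
Qed.

(** At the scale [delta = hi ^+ k], the number of squares is comparable to the mass
of exponent 0 divided by [delta], hence to [delta `^ (- s)] times the mass of
exponent [s - 1]. *)
Lemma is_box_dim_graph (R : realType) (m : nat) (b : nat -> R)
    (y : seq 'I_m -> nat -> R) (f : R -> R) (lo hi s c1 c2 : R) (j : nat) :
  (0 < m)%N -> is_partition m b ->
  (forall u k, 0 <= y u k <= 1) -> (forall u, y u 0%N = 0) ->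
  (forall u, y u m = 1) ->
  {within `[0, 1], continuous f} -> limit_set b y = graph01 f ->
  0 < lo -> (forall i : 'I_m, lo <= width b i) ->
  0 < hi -> hi < 1 -> (forall i : 'I_m, width b i <= hi) ->
  1 <= s -> 0 < c1 ->
  (forall k, (j <= k)%N -> c1 <= mass b y (s - 1) k (hi ^+ k) [::] <= c2) ->
  is_box_dim (graph01 f) s.
Proof.
move=> m0 hb y01 y0 ym fc fg lo0 loi hi0 hi1 hii s1 c10 pinch.
have p0 : 0 <= s - 1 by rewrite subr_ge0.
have lo1 : lo <= 1 by rewrite (le_trans (loi (Ordinal m0)))// width_le1.
have dX k : 0 < hi ^+ k by rewrite exprn_gt0.
have sizes k w : w \in cutset m b k (hi ^+ k) ->
    lo * hi ^+ k <= widthw b w <= hi ^+ k.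
  move=> wC; apply/andP; split; last first.
    exact (cutset_widthw_le hb hi0 hii (lexx _) wC).
  apply: (cutset_widthw_ge hb lo0 loi lo1 _ wC).
  by rewrite dX exprn_ile1// ltW.
have powE k : (hi ^+ k) `^ s = (hi ^+ k) `^ (s - 1) * hi ^+ k.
  rewrite -{1}(subrK 1 s) (@powRD _ _ (s - 1) 1); last first.
    by rewrite (gt_eqF (dX k)) implybT.
  by rewrite powRr1// ltW.
apply: (@is_box_dim_geometric _ _ hi s (lo * c1 / 3)
  ((1 + lo^-1) / lo `^ (s - 1) * c2)).
- by rewrite hi0.
- exact: le_trans s1.
- by rewrite !mulr_gt0// invr_gt0.
- exists j => // k /= jk n nC.
  have /andP[h1 _] := pinch k jk.
  have h2 := coverable_graph_ge hb y01 y0 ym m0 fc fg lo0 (dX k) (sizes k) nC.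
  have h3 := mass_le_mass0 hb hi0 hii y [::] p0 (lexx (hi ^+ k)).
  rewrite ler_pdivrMr// powE.
  apply: (@le_trans _ _ (lo * ((hi ^+ k) `^ (s - 1) *
      mass b y 0 k (hi ^+ k) [::]))).
    by rewrite ler_wpM2l ?(ltW lo0)// (le_trans h1).
  rewrite mulrCA.
  apply: (@le_trans _ _ ((hi ^+ k) `^ (s - 1) * (3 * hi ^+ k * n%:R))).
    by rewrite ler_wpM2l ?powR_ge0.
  by rewrite le_eqVlt; apply/orP; left; apply/eqP; ring.
- exists j.+1 => // k /= jk.
  have /andP[_ h1] := pinch k (ltnW jk).
  have k0 : (0 < k)%N by exact: leq_ltn_trans jk.
  have [n nC h2] := coverable_limit_set hb y01 k0 lo0 (dX k) (sizes k).
  exists n; first by rewrite -fg.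
  have h3 := mass0_le_mass hb lo0 loi y k [::] lo1 p0 (_ : 0 < hi ^+ k <= 1).
  have {}h3 := h3 _; rewrite dX exprn_ile1 ?(ltW hi0) ?(ltW hi1)// in h3.
  have h4 := mass0_ge1 hb y0 ym k (hi ^+ k) [::].
  set S := mass b y 0 k (hi ^+ k) [::] in h2 h3 h4.
  rewrite powE mulrCA.
  have lop : 0 < lo `^ (s - 1) by rewrite powR_gt0.
  apply: (@le_trans _ _ ((hi ^+ k) `^ (s - 1) * ((1 + lo^-1) * S))).
    rewrite ler_wpM2l ?powR_ge0//; apply: le_trans h2 _.
    by rewrite mulrDl mul1r lerD2l ler_peMr// invr_ge0 ltW.
  rewrite mulrCA -[leRHS]mulrA ler_wpM2l ?addr_ge0 ?invr_ge0 ?(ltW lo0)//.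
  rewrite mulrC ler_pdivlMl//; apply: le_trans h1; apply: le_trans (h3 isT).
  by rewrite powRM ?(ltW lo0) ?(ltW (dX k))// -mulrA [S * _]mulrC.
Qed.
Lemma expectation_height_sum (d : measure_display) (Th : measurableType d)
    (R : realType) (P : probability Th R) (m : nat) (b : nat -> R)
    (Y : seq 'I_m.+2 -> {RV P >-> rvec R m.+1})
    (Y01 : forall u t j, 0 <= tnth (Y u t) j <= 1) (r : R) :
  ('E_P[(fun t => \sum_(i < m.+2)
     height (y_ Y t) [::] i * width b i `^ r)%R] =
   (\sum_(i < m.+2) mean_height Y i * width b i `^ r)%R%:E)%E.
Proof.
have oh (i : 'I_m.+2) : observable Y [set [::]]
    (fun t => height (y_ Y t) [::] i) by exact: observable_height.
have ohl (i : 'I_m.+2) : observable Y [set [::]]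
    (fun t => height (y_ Y t) [::] i * width b i `^ r).
  by apply: observableM => //; exact: observable_cst.
rewrite unlock -[LHS]fineK; last first.
  exact (integrable_fin_num measurableT
    (observable_integrable (observable_sum (index_enum _) ohl))).
congr EFin; rewrite -/(Rintegral _ _ _) (Rintegral_sum_observable _ ohl).
apply: eq_bigr => i _; rewrite RintegralZr//.
exact: observable_integrable (oh i).
Qed.

Theorem theorem2p4 (R : realType) (d : measure_display)
    (Th : measurableType d) (P : probability Th R)
    (m : nat) (hm : (2 <= m)%N)
    (b : nat -> R) (hb : is_partition m b)
    (Y : seq 'I_m -> {RV P >-> rvec R m.-1})
    (Y01 : forall (w : seq 'I_m) (t : Th) (j : 'I_m.-1),
      0 <= tnth (Y w t) j <= 1)
    (Yindep : mutually_independent Y)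
    (Yid : identically_distributed Y)
    (hy01 : forall i : nat, (1 <= i <= m.-1)%N ->
      P [set t | y_ Y t [::] i = 0 \/ y_ Y t [::] i = 1] = 0%E)
    (hyb : forall i : nat, (1 <= i <= m.-1)%N ->
      (P [set t | (y_ Y t [::] i.+1 - y_ Y t [::] i = b i.+1 - b i)%R] < 1)%E)
    (F : Th -> R -> R) (hF : random_self_affine_function b Y F) :
  exists s : R,
    unique (fun r : R =>
      (1 = 'E_P[(fun t => \sum_(i < m)
        `|y_ Y t [::] i.+1 - y_ Y t [::] i| * (b i.+1 - b i) `^ (r - 1))%R])%E)
      s /\
    {ae P, forall t, is_box_dim (graph01 (F t)) s}.
Proof.
case: m hm hb Y Y01 Yindep Yid hy01 hyb hF => [|[|m]]// _ hb Y Y01 Yindep Yid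
  hy01 _ hF.
have [lo [hi [lo0 loi hi0 hi1 hii]]] := width_bounds hb.
have expE (r : R) : ('E_P[(fun t => \sum_(i < m.+2)
      `|y_ Y t [::] i.+1 - y_ Y t [::] i| * (b i.+1 - b i) `^ (r - 1))%R] =
    (\sum_(i < m.+2) mean_height Y i * width b i `^ (r - 1))%R%:E)%E.
  exact: expectation_height_sum.
have [s s1 [sE suniq]] := exists_exponent
  (fun i : 'I_m.+2 => mean_height_ge0 Y i) (fun i : 'I_m.+2 => mean_height_le1 Y01 i)
  (sum_mean_height_ge1 Y01) (width_gt0 hb) (fun i => le_lt_trans (hii i) hi1)
  (sum_width hb).
exists s; split.
  split; first by rewrite expE sE.
  by move=> r; rewrite expE => -[] /esym; exact: suniq.
have p0 : 0 <= s - 1 by rewrite subr_ge0.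
have := level_mass_pinched hb Y01 Yindep Yid p0 sE lo0 loi hi0 hi1 hii hy01 [::].
apply: filterS2 hF => t [fc _ fg] [c1 [c2 [j [c10 pinch]]]].
exact: (is_box_dim_graph (m := m.+2) isT hb (y_itv Y01 t) (y_first Y t) (y_last Y t)
  fc fg lo0 loi hi0 hi1 hii s1 c10 pinch).
Qed.
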